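(* Suppose $G$ and $\pi:\mathrm{cl}(X\times Y\times Z)\to\mathbb{R}$ satisfy hypotheses (G0)-(G5) stated in the context. Then the following statements are equivalent: (i) $t\in[0,1]\mapsto \pi(x,y_t,z_t)$ is concave along all $G$-segments $t\mapsto (x,y_t,z_t)$ (for all $x\in X$); (ii) for every Borel probability measure $\mu$ on $X$ with $\mu\ll\mathcal{L}^m$, the functional $\boldsymbol{\Pi}(u)=\int_X \pi\big(x,\bar y_G(x,u(x),Du(x))\big)\,d\mu(x)$ is concave on $\mathcal{U}$, the set of all $G$-convex functions $u:X\to\mathbb{R}$.
   Context: Setting. $m\ge n$; $X\subset\mathbb{R}^m$, $Y\subset\mathbb{R}^n$; $Z=(\underline z,\bar z)$; $\mathrm{cl}$ denotes closure in Euclidean space. Subscripts denote partial derivatives, e.g. $G_x=(\partial G/\partial x^1,\dots,\partial G/\partial x^m)$, $G_z=\partial G/\partial z$. $\mathcal{L}^m$ is Lebesgue measure on $\mathbb{R}^m$; $\mu\ll\mathcal{L}^m$ means absolute continuity. (G0) $G\in C^1(\mathrm{cl}(X\times Y\times Z))$, where $X\subset\mathbb{R}^m$, $Y\subset\mathbb{R}^n$ are open and bounded and $Z=(\underline z,\bar z)$ with $-\infty<\underline z<\bar z\le+\infty$. (G1) For each $x\in X$, the map $(y,z)\in \mathrm{cl}(Y\times Z)\mapsto (G_x,G)(x,y,z)\in\mathbb{R}^{m+1}$ is a homeomorphism onto its range. (G2) For each $x\in X$, the range $(G_x,G)(x,\mathrm{cl}(Y\times Z))$ is convex. $G$-segments: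 for $x_0\in X$ and $(y_0,z_0),(y_1,z_1)\in \mathrm{cl}(Y\times Z)$, let $(y_t,z_t)\in \mathrm{cl}(Y\times Z)$ be the unique solution of $(G_x,G)(x_0,y_t,z_t)=(1-t)(G_x,G)(x_0,y_0,z_0)+t(G_x,G)(x_0,y_1,z_1)$, $t\in[0,1]$. The curve $t\mapsto(x_0,y_t,z_t)$ is the $G$-segment connecting $(x_0,y_0,z_0)$ and $(x_0,y_1,z_1)$. (G3) For each $x,x_0\in X$, $t\in[0,1]\mapsto G(x,y_t,z_t)$ is convex along every $G$-segment $t\mapsto(x_0,y_t,z_t)$. (G4) $G_z(x,y,z)<0$ for each $(x,y,z)\in X\times \mathrm{cl}(Y)\times \mathrm{cl}(Z)$. (G5) $\pi\in C^0(\mathrm{cl}(X\times Y\times Z))$ and $u_\emptyset(x):=G(x,y_\emptyset,z_\emptyset)$ for some fixed $(y_\emptyset,z_\emptyset)\in \mathrm{cl}(Y\times Z)$ satisfying $G(x,y,\bar z):=\lim_{z\to\bar z}G(x,y,z)\le G(x,y_\emptyset,z_\emptyset)$ for all $(x,y)\in X\times \mathrm{cl}(Y)$. When $\bar z=+\infty$ this inequality is assumed strict, and moreover for all sufficiently large $z$, $G(x,y,z)<G(x,y_\emptyset,z_\emptyset)$ for all $(x,y)\in X\times \mathrm{cl}(Y)$. $G$-convexity: $u\in C^0(X)$ is $G$-convex if for each $x_0\in X$ there exist $y_0\in \mathrm{cl}(Y)$, $z_0\in \mathrm{cl}(Z)$ with $u(x_0)=G(x_0,y_0,z_0)$ and $u(x)\ge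 G(x,y_0,z_0)$ for all $x\in X$. If $u$ is $G$-convex and differentiable at $x$, then $\bar y_G(x,u(x),Du(x))$ denotes the unique $(y,z)\in \mathrm{cl}(Y\times Z)$ with $u(x)=G(x,y,z)$ and $Du(x)=G_x(x,y,z)$. The set of points of $X$ where a $G$-convex $u$ is not differentiable is Lebesgue null, so the integrand in $\boldsymbol{\Pi}(u)$ is defined $\mu$-a.e. *)

(* Defs.v *)
From HB Require Import structures.
From mathcomp Require Import all_boot all_order all_algebra.
From mathcomp Require Import all_classical all_reals all_analysis.
Set Implicit Arguments.
Unset Strict Implicit.
Unset Printing Implicit Defensive.
Import Order.TTheory GRing.Theory Num.Theory.
Import numFieldNormedType.Exports.
Local Open Scope classical_set_scope.
Local Open Scope ring_scope.

(* R^m x R^n x R is represented as R^m x (R^n x R): the pairs q = (y, z) move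
   together in all the hypotheses. *)
Notation yzT R n := ('rV[R]_n * R)%type.
Notation xyzT R m n := ('rV[R]_m * ('rV[R]_n * R))%type.

(* The open interval Z = (zlo, zhi), where zhi may be +oo. *)
Definition Zset (R : realType) (zlo : R) (zhi : \bar R) : set R :=
  [set z | zlo < z /\ (z%:E < zhi)%E].

(* Functions on cl(D) are represented by total functions whose values outside
   cl(D) are never used.  G is C^1 on cl(D), D open: G is continuous on cl(D),
   its first partial derivatives exist on D, and they extend continuously to
   cl(D).  The extension dG = (G_x, (G_y, G_z)) is unique on cl(D). *)
Definition C1_closure (R : realType) (m n : nat) (D : set (xyzT R m n))
    (G : xyzT R m n -> R) (dG : xyzT R m n -> xyzT R m n) : Prop :=
  [/\ {within closure D, continuous G},
      {within closure D, continuous dG} &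
      forall p, D p ->
        [/\ forall i : 'I_m,
              is_derive p ((delta_mx 0 i, (0, 0)) : xyzT R m n) G ((dG p).1 0 i),
            forall j : 'I_n,
              is_derive p ((0, (delta_mx 0 j, 0)) : xyzT R m n) G
                ((dG p).2.1 0 j) &
            is_derive p ((0, (0, 1)) : xyzT R m n) G (dG p).2.2]].

Definition homeo_onto_range (T U : topologicalType) (A : set T) (f : T -> U) :=
  {within A, continuous f} /\
  exists g : U -> T,
    {within f @` A, continuous g} /\ forall a, A a -> g (f a) = a.

Definition concave_function (R : realType) (E : lmodType R)
    (D : set (convex_lmodType E)) (f : E -> R) : Prop :=
  @convex_function R E D (fun x => - f x).

(* The set U is required to be convex; F may take infinite values, and sums
   follow the convention +oo + -oo = -oo. *)
Definition concave_functional (R : realType) (V : lmodType R)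
    (U : set V) (F : V -> \bar R) : Prop :=
  convex_set U /\
  forall u0 u1, U u0 -> U u1 -> forall t : R, 0 <= t <= 1 ->
    ((1 - t)%:E * F u0 + t%:E * F u1 <= F ((1 - t) *: u0 + t *: u1)%R)%E.

(* The map q |-> (G_x, G)(x, q). *)
Definition GxG (R : realType) (m n : nat) (G : xyzT R m n -> R)
    (dG : xyzT R m n -> xyzT R m n) (x : 'rV[R]_m) (q : yzT R n)
    : ('rV[R]_m * R)%type :=
  ((dG (x, q)).1, G (x, q)).

(* q, restricted to [0, 1], is the curve t |-> (y_t, z_t) of the G-segment
   at x0 connecting q0 to q1. *)
Definition G_segment (R : realType) (m n : nat) (G : xyzT R m n -> R)
    (dG : xyzT R m n -> xyzT R m n) (clYZ : set (yzT R n)) (x0 : 'rV[R]_m)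
    (q0 q1 : yzT R n) (q : R -> yzT R n) : Prop :=
  [/\ clYZ q0, clYZ q1 &
    forall t, 0 <= t <= 1 ->
      clYZ (q t) /\
      GxG G dG x0 (q t) = (1 - t) *: GxG G dG x0 q0 + t *: GxG G dG x0 q1].

Definition hypG0 (R : realType) (m n : nat) (X : set 'rV[R]_m)
    (Y : set 'rV[R]_n) (zlo : R) (zhi : \bar R) (G : xyzT R m n -> R)
    (dG : xyzT R m n -> xyzT R m n) : Prop :=
  [/\ open X /\ bounded_set X, open Y /\ bounded_set Y, (zlo%:E < zhi)%E &
      C1_closure (X `*` (Y `*` Zset zlo zhi)) G dG].

Definition hypG1 (R : realType) (m n : nat) (X : set 'rV[R]_m)
    (clYZ : set (yzT R n)) (G : xyzT R m n -> R)
    (dG : xyzT R m n -> xyzT R m n) : Prop :=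
  forall x, X x -> homeo_onto_range clYZ (GxG G dG x).

Definition hypG2 (R : realType) (m n : nat) (X : set 'rV[R]_m)
    (clYZ : set (yzT R n)) (G : xyzT R m n -> R)
    (dG : xyzT R m n -> xyzT R m n) : Prop :=
  forall x, X x -> convex_set (GxG G dG x @` clYZ).

Definition hypG3 (R : realType) (m n : nat) (X : set 'rV[R]_m)
    (clYZ : set (yzT R n)) (G : xyzT R m n -> R)
    (dG : xyzT R m n -> xyzT R m n) : Prop :=
  forall x x0, X x -> X x0 -> forall q0 q1 q,
    G_segment G dG clYZ x0 q0 q1 q ->
    @convex_function R R^o `[0, 1] (fun t => G (x, q t)).

Definition hypG4 (R : realType) (m n : nat) (X : set 'rV[R]_m)
    (Y : set 'rV[R]_n) (Z : set R) (dG : xyzT R m n -> xyzT R m n) : Prop :=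
  forall x y z, X x -> closure Y y -> closure Z z -> (dG (x, (y, z))).2.2 < 0.

(* The filter "z -> zhi" on the reals below zhi. *)
Definition to_upper_end (R : realType) (zhi : \bar R) : set_system R :=
  if zhi is r%:E then at_left r else pinfty_nbhs R.

(* G(x, y, zhi), an extended real when zhi = +oo. *)
Definition G_upper_end (R : realType) (m n : nat) (zhi : \bar R)
    (G : xyzT R m n -> R) (x : 'rV[R]_m) (y : 'rV[R]_n) : \bar R :=
  lim ((G (x, (y, z)))%:E @[z --> to_upper_end zhi]).

(* q_null = (y_null, z_null) is the null product, whose payoff is
   u_null(x) = G(x, q_null). *)
Definition hypG5 (R : realType) (m n : nat) (X : set 'rV[R]_m)
    (Y : set 'rV[R]_n) (zlo : R) (zhi : \bar R) (G profit : xyzT R m n -> R)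
    (q_null : yzT R n) : Prop :=
  let Z := Zset zlo zhi in
  [/\ {within closure (X `*` (Y `*` Z)), continuous profit},
      closure (Y `*` Z) q_null,
      (forall x y, X x -> closure Y y ->
         (G_upper_end zhi G x y <= (G (x, q_null))%:E)%E) &
      zhi = +oo%E ->
        (forall x y, X x -> closure Y y ->
           (G_upper_end zhi G x y < (G (x, q_null))%:E)%E) /\
        (\forall z \near +oo, forall x y, X x -> closure Y y ->
           G (x, (y, z)) < G (x, q_null))].

(* The set of G-convex functions on X; values outside X are irrelevant. *)
Definition G_convex (R : realType) (m n : nat) (X : set 'rV[R]_m)
    (Y : set 'rV[R]_n) (Z : set R) (G : xyzT R m n -> R)
    : set ('rV[R]_m -> R^o) :=
  [set u | {within X, continuous u} /\
    forall x0, X x0 -> exists y0 z0,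
      [/\ closure Y y0, closure Z z0, u x0 = G (x0, (y0, z0)) &
          forall x, X x -> G (x, (y0, z0)) <= u x]].

Definition gradient (R : realType) (m : nat) (u : 'rV[R]_m -> R)
    (x : 'rV[R]_m) : 'rV[R]_m :=
  \row_i 'D_(delta_mx 0 i) u x.

(* The unique q in cl(Y x Z) with G(x, q) = a and G_x(x, q) = p
   (an arbitrary point when there is none). *)
Definition ybarG (R : realType) (m n : nat) (G : xyzT R m n -> R)
    (dG : xyzT R m n -> xyzT R m n) (clYZ : set (yzT R n))
    (x : 'rV[R]_m) (a : R) (p : 'rV[R]_m) : yzT R n :=
  get [set q | [/\ clYZ q, a = G (x, q) & p = (dG (x, q)).1]].

Definition borelRV (R : realType) (m : nat) :=
  g_sigma_algebraType (@open 'rV[R]_m).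

(* Lebesgue (outer) measure on R^m, m > 0, through countable covers by closed
   boxes. *)
Definition lebesgueRV (R : realType) (m : nat) (A : set (borelRV R m))
    : \bar R :=
  ereal_inf [set s | exists a b : nat -> 'rV[R]_m,
    [/\ forall k i, a k 0 i <= b k 0 i,
        A `<=` \bigcup_k [set x : 'rV[R]_m | forall i, a k 0 i <= x 0 i <= b k 0 i] &
        s = (\sum_(0 <= k <oo) (\prod_i (b k 0 i - a k 0 i))%:E)%E]].

(* The integral runs over the points of X where u is differentiable, the only
   ones where the integrand is defined. *)
Definition profit_functional (R : realType) (m n : nat) (X : set 'rV[R]_m)
    (clYZ : set (yzT R n)) (G : xyzT R m n -> R)
    (dG : xyzT R m n -> xyzT R m n) (profit : xyzT R m n -> R)
    (mu : probability (borelRV R m) R) (u : 'rV[R]_m -> R^o) : \bar R :=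
  (\int[mu]_(x in (X `&` [set x | differentiable u x] : set (borelRV R m)))
     (profit (x, ybarG G dG clYZ x (u x) (gradient u x)))%:E)%E.

(* Main.v *)
Require Import Defs.
From HB Require Import structures.
From mathcomp Require Import all_boot all_order all_algebra.
From mathcomp Require Import all_classical all_reals all_analysis.
From mathcomp Require Import measurable_realfun ring lra.
Import Order.TTheory GRing.Theory Num.Theory.
Import numFieldNormedType.Exports.
Local Open Scope classical_set_scope.
Local Open Scope ring_scope.

(* A support of a G-convex function u at x is a product q with u(x) = G(x, q)
   and G(., q) <= u on X.  Where u is differentiable its only support is
   ybarG(x, u(x), Du(x)), and conversely a G-convex function is differentiable
   wherever its support is unique.  By (G3), if q0 and q1 support u0 and u1 at x,
   then the point q_t of the G-segment at x joining them supports
   (1 - t) u0 + t u1: hence the set of G-convex functions is convex, and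
   concavity of the profit along G-segments is pointwise concavity of the
   integrand of the functional.

   Conversely, apply the concavity of the functional to u0 = G(., q0) and
   u1 = G(., q1), which are differentiable everywhere, and to the uniform
   probability on a small cube around x: the integrands are continuous, so a
   failure of concavity at x would persist on the cube.

   The points of non-differentiability form a Lebesgue null Borel set: at such a
   point two supports have different partial derivatives in some direction i, so
   u has an i-th kink there, and the kinks of a given strength and scale form
   a compact set meeting each short segment parallel to the i-th axis at most
   once, that is, the graph of a uniformly continuous function.  Supports at
   points of differentiability depend continuously on the point although Z may be
   unbounded, because the G-segment leading to a far away support crosses a
   fixed compact sphere. *)

Set Implicit Arguments.
Unset Strict Implicit.
Unset Printing Implicit Defensive.

(** * Differential calculus *)

Section RowVectors.
Context {R : realType} {m : nat}.
Implicit Types x y p h : 'rV[R]_m.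

Lemma rV_norm_le x (e : R) : 0 <= e ->
  (`|x| <= e) <-> (forall i, `|x 0 i| <= e).
Proof.
move=> e0; rewrite [`|x|]/Num.norm /= mx_normrE; split.
  move=> /bigmax_leP[_ H] i; exact: (H (0, i)).
by move=> H; apply/bigmax_leP; split=> // -[i j] _ /=; rewrite ord1.
Qed.

Lemma rV_norm_lt x (e : R) : 0 < e ->
  (`|x| < e) <-> (forall i, `|x 0 i| < e).
Proof.
move=> e0; rewrite [`|x|]/Num.norm /= mx_normrE; split.
  move=> /bigmax_ltP[_ H] i; exact: (H (0, i)).
by move=> H; apply/bigmax_ltP; split=> // -[i j] _ /=; rewrite ord1.
Qed.

Lemma rV_coord_le x i : `|x 0 i| <= `|x|.
Proof. by move: i; apply/rV_norm_le. Qed.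

Definition dotrV p h : R^o := \sum_i p 0 i * h 0 i.

Lemma dotrV_linear p : linear (dotrV p).
Proof.
move=> a x y; rewrite /dotrV /= scaler_sumr -big_split; apply: eq_bigr => i _.
by rewrite !mxE mulrDr mulrCA.
Qed.

HB.instance Definition _ p :=
  GRing.isLinear.Build R 'rV[R]_m R^o *:%R (dotrV p) (dotrV_linear p).

Lemma dotrV_continuous p : continuous (dotrV p).
Proof.
have -> : dotrV p = \sum_i (fun h : 'rV[R]_m => (p 0 i * h 0 i : R^o)).
  by apply/funext => h; rewrite fct_sumE.
elim/big_ind : _ => [x|f g fc gc x|i _ x].
- exact: (@cst_continuous _ _ (0 : R^o)).
- exact: (continuousD (fc x) (gc x)).
- by apply: (@cvgMl_tmp _ _ (nbhs x)); exact: coord_continuous.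
Qed.

Lemma dotrV_delta p i s : dotrV p (s *: delta_mx 0 i) = s * p 0 i.
Proof.
rewrite /dotrV (bigD1 i)//= big1 ?addr0; last first.
  by move=> j ji; rewrite !mxE (negbTE ji) !mulr0.
by rewrite !mxE !eqxx mulr1 mulrC.
Qed.

End RowVectors.

Lemma is_derive_line (R : realType) (V : normedModType R) (f : V -> R) (a v : V)
    (r d : R) :
  is_derive (a + r *: v) v f d -> is_derive r 1 (fun s : R => f (a + s *: v)) d.
Proof.
have E : (fun h : R => h^-1 *: (((fun s : R => f (a + s *: v)) \o shift r) (h *: 1) -
     f (a + r *: v))) =
   (fun h : R => h^-1 *: ((f \o shift (a + r *: v)) (h *: v) - f (a + r *: v))).
  apply/funext => h /=; congr (_ *: (f _ - _)).
  by rewrite [in RHS]addrCA -scalerDl /GRing.scale/= mulr1.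
move=> [H1 H2]; split.
  by rewrite /derivable E.
by rewrite /derive E.
Qed.

(** The increment is split along a staircase from x to x' that changes one coordinate at a time and
    stays in the sup-norm ball around c; the mean value theorem bounds each of the m edges. *)
Lemma partial_increment_le (R : realType) (m : nat) (f : 'rV[R]_m -> R)
    (p c : 'rV[R]_m) (d e : R) : 0 <= e ->
  (forall x, `|x - c| < d -> forall i,
     exists2 v, is_derive x (delta_mx 0 i) f v & `|v - p 0 i| <= e) ->
  forall x x', `|x - c| < d -> `|x' - c| < d ->
    `|f x' - f x - dotrV p (x' - x)| <= m%:R * e * `|x' - x|.
Proof.
move=> e0 H x x' xd x'd.
have d0 : 0 < d by exact: le_lt_trans xd.
pose z k : 'rV[R]_m := \row_j (if (j < k)%N then x' 0 j else x 0 j).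
have z0 : z 0%N = x by apply/rowP => j; rewrite mxE ltn0.
have zm : z m = x' by apply/rowP => j; rewrite mxE ltn_ord.
have zS (i : 'I_m) : z i.+1 = z i + (x' 0 i - x 0 i) *: delta_mx 0 i.
  apply/rowP => j; rewrite !mxE eqxx/= ltnS leq_eqVlt.
  have [->|ji] := eqVneq j i; first by rewrite eqxx ltnn mulr1 addrC subrK.
  by rewrite -val_eqE/= in ji; rewrite (negbTE ji) mulr0 addr0.
have step (i : 'I_m) :
    `|f (z i.+1) - f (z i) - (x' 0 i - x 0 i) * p 0 i| <= e * `|x' - x|.
  rewrite zS; set s := x' 0 i - x 0 i; set a := z i.
  pose phi (r : R) := f (a + r *: delta_mx 0 i).
  (* The condition says that r lies between 0 and s, whatever the sign of s; the mean value theorem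
     below is applied on the interval ordered accordingly. *)
  have inb r : (0 <= r <= s) || (s <= r <= 0) -> `|a + r *: delta_mx 0 i - c| < d.
    move=> rs; apply/rV_norm_lt => // j.
    have := rV_norm_lt (x - c) d0; move=> [/(_ xd j) + _]; rewrite !mxE => A.
    have := rV_norm_lt (x' - c) d0; move=> [/(_ x'd j) + _]; rewrite !mxE => B.
    rewrite eqxx/=; have [ji|ji] := eqVneq j i; last first.
      by rewrite mulr0 addr0; case: ifP.
    rewrite ji ltnn mulr1; rewrite ji in A B.
    move: A B rs; rewrite /s !ltr_norml => /andP[A1 A2] /andP[B1 B2].
    by case/orP => /andP[r1 r2]; apply/andP; split; lra.
  have drv r : (0 <= r <= s) || (s <= r <= 0) ->
     exists2 v, is_derive r 1 phi v & `|v - p 0 i| <= e.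
    move=> /inb /H /(_ i)[v v1 v2]; exists v => //.
    exact: is_derive_line.
  pose dphi r := 'D_1 phi r.
  have drv' r : (0 <= r <= s) || (s <= r <= 0) ->
     is_derive r 1 phi (dphi r) /\ `|dphi r - p 0 i| <= e.
    by move=> /drv[v v1 v2]; rewrite /dphi derive_val; split.
  have cphi : {in (fun r => (0 <= r <= s) || (s <= r <= 0)), forall r, {for r, continuous phi}}.
    move=> r /drv'[[r1 _] _]; apply: differentiable_continuous.
    exact/derivable1_diffP.
  have [w ws E] : exists2 w, (0 <= w <= s) || (s <= w <= 0) &
      phi s - phi 0 = dphi w * s.
    have [s0|s0] := leP 0 s.
      have [| |w ws E] := @MVT_segment R phi dphi 0 s s0.
      - move=> r; rewrite in_itv/= => /andP[r0 rs].
        by suff /drv'[] : (0 <= r <= s) || (s <= r <= 0);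
          rewrite ?(ltW r0) ?(ltW rs).
      - apply: continuous_in_subspaceT => r; rewrite inE/= in_itv/= => rs.
        by apply: cphi; rewrite unfold_in rs.
      by rewrite subr0 in E; exists w => //; move: ws; rewrite in_itv/= => ->.
    have [| |w ws E] := @MVT_segment R phi dphi s 0 (ltW s0).
    - move=> r; rewrite in_itv/= => /andP[r0 rs].
      by suff /drv'[] : (0 <= r <= s) || (s <= r <= 0);
        rewrite ?(ltW r0) ?(ltW rs) ?orbT.
    - apply: continuous_in_subspaceT => r; rewrite inE/= in_itv/= => rs.
      by apply: cphi; rewrite unfold_in rs orbT.
    exists w; last by rewrite -opprB E sub0r mulrN opprK.
    by move: ws; rewrite in_itv/= => ->; rewrite orbT.
  have {}E : f (a + s *: delta_mx 0 i) - f a = dphi w * s.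
    by rewrite -E /phi scale0r addr0.
  rewrite E mulrC -mulrBr normrM mulrC ler_pM//; first exact: (drv' _ ws).2.
  by have := rV_coord_le (x' - x) i; rewrite !mxE.
have -> : f x' - f x - dotrV p (x' - x) =
    \sum_(i < m) (f (z i.+1) - f (z i) - (x' 0 i - x 0 i) * p 0 i).
  rewrite sumrB -[in LHS]z0 -[in LHS]zm; congr (_ - _).
    by rewrite -(big_mkord xpredT (fun k => f (z k.+1) - f (z k))) telescope_sumr.
  by apply: eq_bigr => i _; rewrite zm z0 !mxE mulrC.
apply: le_trans (ler_norm_sum _ _ _) _.
apply: le_trans (ler_sum _ (fun i _ => step i)) _.
by rewrite sumr_const card_ord -mulrA mulr_natl.
Qed.

Lemma closure_setX (T U : topologicalType) (A : set T) (B : set U) :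
  closure (A `*` B) = closure A `*` closure B.
Proof.
apply/seteqP; split => [[a b] H|[a b] [/= Ha Hb]].
  split => V nV.
    have [|[x y] [[/= Ax By] [/= Vx _]]] := H (V `*` setT).
      by exists (V, setT) => //; split => //; exact: filterT.
    by exists x.
  have [|[x y] [[/= Ax By] [/= _ Vy]]] := H (setT `*` V).
    by exists (setT, V) => //; split => //; exact: filterT.
  by exists y.
move=> V [[V1 V2] /= [n1 n2] sV].
have [x [Ax V1x]] := Ha _ n1; have [y [By V2y]] := Hb _ n2.
by exists (x, y); split => //; exact: sV.
Qed.

Lemma near_distP (R : realType) (V : normedModType R) (x : V) (P : V -> Prop) :
  (\forall y \near x, P y) <->
  exists2 d : R, 0 < d & forall y, `|y - x| < d -> P y.
Proof.
split=> [/nbhs_ballP[d /= d0 H]|[d d0 H]].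
  by exists d => // y yx; apply: H; rewrite -ball_normE /= distrC.
apply/nbhs_ballP; exists d => //= y; rewrite -ball_normE /= => yx.
by apply: H; rewrite distrC.
Qed.

Lemma near2_distP (R : realType) (V W : normedModType R) (x : V) (y : W)
    (P : V -> W -> Prop) :
  (\forall x' \near x & y' \near y, P x' y') <->
  exists2 d : R, 0 < d & forall x' y', `|x' - x| < d -> `|y' - y| < d -> P x' y'.
Proof.
split=> [[[A B] /= [/near_distP[a a0 Ha] /near_distP[b b0 Hb]] sP]|[d d0 H]].
  exists (Num.min a b); first by rewrite lt_min a0.
  move=> x' y'; rewrite !lt_min => /andP[xa _] /andP[_ yb].
  by apply: (sP (x', y')); split; [exact: Ha|exact: Hb].
exists ([set x' | `|x' - x| < d], [set y' | `|y' - y| < d]) => /=.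
  by split; apply/near_distP; exists d.
by move=> [x' y'] [/= ? ?]; exact: H.
Qed.

Section StrictDifferentiability.
Context {R : realType} {m n : nat}.
Variables (X : set 'rV[R]_m) (Q : set (yzT R n)).
Variables (G : xyzT R m n -> R) (dG : xyzT R m n -> xyzT R m n).
Hypotheses (oX : open X) (C1 : C1_closure (X `*` Q) G dG).

Lemma G_cvg x q : X x -> closure Q q ->
  G p @[p --> within (closure (X `*` Q)) (nbhs (x, q))] --> G (x, q).
Proof.
move=> Xx Qq; have [/subspace_continuousP cG _ _] := C1.
by apply: cG; rewrite closure_setX; split=> //=; exact: subset_closure.
Qed.

Lemma dG_cvg x q : X x -> closure Q q ->
  dG p @[p --> within (closure (X `*` Q)) (nbhs (x, q))] --> dG (x, q).
Proof.
move=> Xx Qq; have [_ /subspace_continuousP cG _] := C1.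
by apply: cG; rewrite closure_setX; split=> //=; exact: subset_closure.
Qed.

Lemma near_G x q e : X x -> closure Q q -> 0 < e ->
  \forall q' \near q & x' \near x, X x' -> closure Q q' ->
    `|G (x, q) - G (x', q')| < e /\
    `|(dG (x, q)).1 - (dG (x', q')).1| < e.
Proof.
move=> Xx Qq e0.
have /cvgrPdist_lt /(_ e e0) H1 := G_cvg Xx Qq.
have /cvgrPdist_lt /(_ e e0) H2 := dG_cvg Xx Qq.
have := filterI H1 H2; rewrite closure_setX => -[[V1 V2] /= [n1 n2] sV].
exists (V2, V1) => // -[q' x'] [/= V2q V1x] Xx' Qq'.
have [] := sV (x', q') (conj V1x V2q) (conj (subset_closure Xx') Qq').
move=> ? H; split => //; apply: le_lt_trans H.
by rewrite [leRHS]prod_normE le_max lexx.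
Qed.

(** Partial derivatives are given only for q in Q, so the estimate is first proved there, by
    comparing them with the gradient at (x0, q0), and then carried to the closure by continuity of
    G. Uniformity in q matters because the support of a G-convex function moves with the point. *)
Lemma G_strict_diff x0 q0 e : X x0 -> closure Q q0 -> 0 < e ->
  exists2 d, 0 < d & forall x x' q, closure Q q -> `|q - q0| < d ->
    `|x - x0| < d -> `|x' - x0| < d ->
    `|G (x', q) - G (x, q) - dotrV (dG (x0, q0)).1 (x' - x)| <= e * `|x' - x|.
Proof.
move=> Xx0 Qq0 e0.
(* The staircase has m edges; dividing by m + 1 also covers m = 0. *)
pose e1 := e / m.+1%:R; have e10 : 0 < e1 by rewrite divr_gt0.
have /near2_distP[d1 d10 H1] := near_G Xx0 Qq0 e10.
have /near_distP[d2 d20 H2] : \forall x \near x0, X x by exact: open_nbhs_nbhs.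
have [d d0 [dd1 dd2]] : exists2 d, 0 < d & d <= d1 /\ d <= d2.
  by exists (Num.min d1 d2); rewrite ?lt_min ?d10// !ge_min !lexx orbT.
exists d => // x x' q Qq qd xd x'd.
have XP y : `|y - x0| < d -> X y by move/lt_le_trans => /(_ _ dd2) /H2.
have e1m : m%:R * e1 <= e.
  rewrite /e1 mulrCA ler_piMr ?(ltW e0)// ler_pdivrMr// mul1r ler_nat.
  exact: leqnSn.
have inQ q' : Q q' -> `|q' - q0| < d ->
    `|G (x', q') - G (x, q') - dotrV (dG (x0, q0)).1 (x' - x)| <= e * `|x' - x|.
  move=> Qq' q'd; apply: le_trans (ler_wpM2r (normr_ge0 _) e1m).
  apply: (@partial_increment_le _ _ (fun y => G (y, q')) _ x0 d) => //.
    exact: ltW.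
  move=> y yd i; have Xy := XP y yd.
  have [_ _ /(_ (y, q') (conj Xy Qq'))[/(_ i) [D1 D2] _ _]] := C1.
  have E : (fun h : R => h^-1 *: (((fun z => G (z, q')) \o shift y) (h *: delta_mx 0 i) - G (y, q'))) =
    (fun h : R => h^-1 *: ((G \o shift (y, q')) (h *: ((delta_mx 0 i, (0, 0)) : xyzT R m n)) - G (y, q'))).
    apply/funext => h /=; congr (_ *: (G _ - _)).
    by case: q' {Qq' q'd D1 D2} => q1 q2; congr (_, (_, _)) => /=;
      rewrite scaler0 add0r.
  exists ((dG (y, q')).1 0 i).
    by split; [rewrite /derivable E|rewrite /derive E].
  have := H1 q' y (lt_le_trans q'd dd1) (lt_le_trans yd dd1) Xy.
  move=> /(_ (subset_closure Qq'))[_].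
  move=> /ltW; apply: le_trans; rewrite distrC.
  by have := rV_coord_le ((dG (x0, q0)).1 - (dG (y, q')).1) i; rewrite !mxE.
(* Passage from Q to its closure: q is replaced by a nearby q' in Q, at a cost of eta / 2 at each of
   x and x'. *)
apply/ler_addgt0Pr => eta eta0.
have Xx := XP x xd; have Xx' := XP x' x'd.
have eta20 : 0 < eta / 2 by rewrite divr_gt0.
have /near2_distP[r1 r10 K1] := near_G Xx Qq eta20.
have /near2_distP[r2 r20 K2] := near_G Xx' Qq eta20.
have : \forall q' \near q, [/\ `|q' - q| < r1, `|q' - q| < r2 & `|q' - q0| < d].
  apply/near_distP; exists (Num.min r1 (Num.min r2 (d - `|q - q0|))).
    by rewrite !lt_min r10 r20 subr_gt0.
  move=> q'; rewrite !lt_min => /and3P[-> -> q'q]; split => //.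
  by rewrite -(subrKA q) (le_lt_trans (ler_normD _ _))// -ltrBrDr.
move=> /Qq[q' [Qq' [q'1 q'2 q'd]]].
have := inQ q' Qq' q'd; set D := dotrV _ _; set E := e * _.
have := K1 q' x q'1; rewrite subrr normr0 => /(_ r10 Xx (subset_closure Qq'))[+ _].
have := K2 q' x' q'2; rewrite subrr normr0 => /(_ r20 Xx' (subset_closure Qq'))[+ _].
rewrite !ltr_norml !ler_norml => /andP[a1 a2] /andP[b1 b2] /andP[c1 c2].
by apply/andP; split; lra.
Qed.
End StrictDifferentiability.

Lemma derivable_near_le (R : realType) (V : normedModType R) (u : V -> R^o)
    (x v : V) (e : R) : derivable u x v -> 0 < e ->
  exists2 d : R, 0 < d & forall h : R, `|h| < d ->
    `|u (x + h *: v) - u x - h * 'D_v u x| <= e * `|h|.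
Proof.
move=> /derivable_nbhs /eqaddoE /eqaddoP /(_ e) H e0.
have /near_distP[d d0 Hd] := H e0.
exists d => // h hd; have := Hd h; rewrite subr0 => /(_ hd) K.
suff -> : u (x + h *: v) - u x - h * 'D_v u x =
    u (h *: v + x) - (u x + h * 'D_v u x) by exact: K.
by rewrite (addrC x) opprD addrA.
Qed.

(** A bound from below on the increments suffices: divided by a small negative h it bounds the
    derivative from above, and by a small positive h from below. *)
Lemma derive_eq_of_ge (R : realType) (V : normedModType R) (u : V -> R^o)
    (x v : V) (p : R) : derivable u x v ->
  (forall e, 0 < e -> exists2 d : R, 0 < d & forall h : R, `|h| < d ->
     h * p - e * `|h| <= u (x + h *: v) - u x) ->
  'D_v u x = p.
Proof.
move=> dux H; apply/eqP; rewrite eq_le; apply/andP; split.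
  apply/ler_addgt0Pr => e e0; have e20 : 0 < e / 2 by rewrite divr_gt0.
  have [d1 d10 H1] := derivable_near_le dux e20.
  have [d2 d20 H2] := H _ e20.
  pose h := - (Num.min d1 d2 / 2).
  have h0 : h < 0 by rewrite oppr_lt0 divr_gt0// lt_min d10.
  have hm : `|h| < Num.min d1 d2.
    by rewrite ltr0_norm// opprK ltr_pdivrMr// ltr_pMr ?ltr1n// lt_min d10.
  have := H1 h; have := H2 h; move: hm; rewrite lt_min => /andP[a1 a2].
  move=> /(_ a2) + /(_ a1); rewrite ler_norml ltr0_norm// => K /andP[_ K'].
  rewrite -(ler_nM2l h0); set D := 'D_v u x in K' *; nra.
apply/ler_addgt0Pr => e e0; have e20 : 0 < e / 2 by rewrite divr_gt0.
have [d1 d10 H1] := derivable_near_le dux e20.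
have [d2 d20 H2] := H _ e20.
pose h := (Num.min d1 d2 / 2).
have h0 : 0 < h by rewrite divr_gt0// lt_min d10.
have hm : `|h| < Num.min d1 d2.
  by rewrite gtr0_norm// ltr_pdivrMr// ltr_pMr ?ltr1n// lt_min d10.
have := H1 h; have := H2 h; move: hm; rewrite lt_min => /andP[a1 a2].
move=> /(_ a2) + /(_ a1); rewrite ler_norml gtr0_norm// => K /andP[_ K'].
rewrite -(ler_pM2l h0); set D := 'D_v u x in K' *; nra.
Qed.

Lemma differentiable_near_le (R : realType) (V W : normedModType R)
    (u : V -> W) (df : {linear V -> W}) (x : V) : continuous df ->
  (forall e : R, 0 < e -> exists2 d : R, 0 < d & forall y, `|y - x| < d ->
     `|u y - u x - df (y - x)| <= e * `|y - x|) ->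
  differentiable u x.
Proof.
move=> cdf H.
have E : u \o shift x = cst (u x) + df +o_ 0 id.
  apply/eqaddoE/eqaddoP => e e0.
  have [d d0 Hd] := H e e0; apply/near_distP; exists d => // h; rewrite subr0 => hd.
  have := Hd (h + x); rewrite addrK => /(_ hd).
  by rewrite -addrA -opprD.
by apply/diff_locallyP; rewrite (diff_unique cdf E).
Qed.

Lemma convex_set_conv (R : realType) (M : lmodType R) (A : set M) (t : R) a b :
  convex_set (A : set (convex_lmodType M)) -> 0 <= t <= 1 -> A a -> A b ->
  A ((1 - t) *: a + t *: b).
Proof.
move=> cA /andP[t0 t1] Aa Ab.
have := cA b a (Itv01 t0 t1); rewrite !inE => /(_ Ab Aa).
by rewrite addrC.
Qed.

Lemma convex_function01 (R : realType) (f : R -> R) (t : R) :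
  @convex_function R R^o `[0, 1] f -> 0 <= t <= 1 ->
  f t <= (1 - t) * f 0 + t * f 1.
Proof.
move=> cf /andP[t0 t1].
have : f (t * 1 + (1 - t) * 0) <= t * f 1 + (1 - t) * f 0.
  by apply: (cf (Itv01 t0 t1) 1 0); rewrite inE/= in_itv/= lexx ler01.
by rewrite mulr1 mulr0 addr0 addrC.
Qed.

Lemma concave_function01 (R : realType) (f : R -> R) (t : R) :
  @concave_function R R^o `[0, 1] f -> 0 <= t <= 1 ->
  (1 - t) * f 0 + t * f 1 <= f t.
Proof.
move=> /(@convex_function01 R (fun x => - f x)) H /H; lra.
Qed.

(** * Supports of G-convex functions *)

Section GConvexity.
Context {R : realType} {m n : nat}.
Variables (X : set 'rV[R]_m) (Q : set (yzT R n)).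
Variables (G : xyzT R m n -> R) (dG : xyzT R m n -> xyzT R m n).
Hypotheses (oX : open X) (C1 : C1_closure (X `*` Q) G dG).
Hypothesis G1 : hypG1 X (closure Q) G dG.
Hypothesis G2 : hypG2 X (closure Q) G dG.
Hypothesis G3 : hypG3 X (closure Q) G dG.

Implicit Types (x : 'rV[R]_m) (q r : yzT R n) (u : 'rV[R]_m -> R^o).

Lemma GxG_inj x q r : X x -> closure Q q -> closure Q r ->
  GxG G dG x q = GxG G dG x r -> q = r.
Proof. by move=> Xx Qq Qr E; have [_ [g [_ gK]]] := G1 Xx;
  rewrite -(gK q)// -(gK r)// E. Qed.

Lemma G_segment_ends x q0 q1 (q : R -> yzT R n) : X x ->
  G_segment G dG (closure Q) x q0 q1 q -> q 0 = q0 /\ q 1 = q1.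
Proof.
move=> Xx [Q0 Q1 H]; split.
  have [|q0Q E] := H 0; first by rewrite lexx ler01.
  by apply: (GxG_inj Xx) => //; rewrite E subr0 scale1r scale0r addr0.
have [|q1Q E] := H 1; first by rewrite lexx ler01.
by apply: (GxG_inj Xx) => //; rewrite E subrr scale1r scale0r add0r.
Qed.

(** By (G2) the straight segment stays in the range, and the inverse from (G1), continuous on the
    range, pulls it back to a continuous curve. *)
Lemma G_segment_exists x q0 q1 : X x -> closure Q q0 -> closure Q q1 ->
  exists2 q, G_segment G dG (closure Q) x q0 q1 q &
    {within `[0, 1], continuous q}.
Proof.
move=> Xx Q0 Q1; have [_ [g [/subspace_continuousP cg gK]]] := G1 Xx.
pose w t := (1 - t) *: GxG G dG x q0 + t *: GxG G dG x q1.
have wR t : 0 <= t <= 1 -> (GxG G dG x @` closure Q) (w t).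
  by move=> t01; apply: convex_set_conv => //; exact: G2.
have cw : continuous w.
  move=> t; apply: cvgD; apply: cvgZr_tmp; last exact: cvg_id.
  by apply: cvgB; [exact: cvg_cst|exact: cvg_id].
exists (g \o w).
  by split => // t /wR /= [q Qq E]; rewrite -E gK.
apply/subspace_continuousP => t; rewrite /= in_itv/= => t01.
have := cg _ (wR t t01); apply: cvg_comp => V; rewrite /within/= => nV.
apply: (@filterS _ (nbhs t)) (cw t _ nV) => s K /=.
by rewrite in_itv/= => s01; apply: K; exact: wR.
Qed.

Lemma G_segment_le x0 x q0 q1 (q : R -> yzT R n) t : X x -> X x0 ->
  G_segment G dG (closure Q) x0 q0 q1 q -> 0 <= t <= 1 ->
  G (x, q t) <= (1 - t) * G (x, q0) + t * G (x, q1).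
Proof.
move=> Xx Xx0 Sq t01; have [<- <-] := G_segment_ends Xx0 Sq.
by apply: (@convex_function01 R (fun t => G (x, q t))) => //; exact: G3 Sq.
Qed.

(** The intermediate value theorem is applied to the distance from q0 along the G-segment; the two
    relations for G come from the definition of the segment at x and from (G3) elsewhere. *)
Lemma G_segment_crossing x q0 q1 e : X x -> closure Q q0 -> closure Q q1 ->
  0 <= e <= `|q1 - q0| ->
  exists s r, [/\ 0 <= s <= 1, closure Q r, `|r - q0| = e,
    G (x, r) = (1 - s) * G (x, q0) + s * G (x, q1) &
    forall x', X x' -> G (x', r) <= (1 - s) * G (x', q0) + s * G (x', q1)].
Proof.
move=> Xx Q0 Q1 /andP[e0 eq]; have [q Sq cq] := G_segment_exists Xx Q0 Q1.
have [q0E q1E] := G_segment_ends Xx Sq.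
have [||s] := @IVT R (fun t => `|q t - q0|) 0 1 e ler01.
- move=> t; apply: (@cvg_norm _ _ _ (nbhs (t : subspace `[0, 1]))).
  by apply: cvgB; [exact: cq|exact: cvg_cst].
- by rewrite q0E q1E subrr normr0 ge_min le_max e0 eq orbT.
rewrite in_itv/= => s01 se; exists s, (q s); have [_ _ /(_ s s01)[Qs Es]] := Sq.
split => //; first by have := congr1 snd Es.
by move=> x' Xx'; exact: G_segment_le Sq s01.
Qed.

Definition supports u x : set (yzT R n) :=
  [set q | [/\ closure Q q, u x = G (x, q) &
    forall x', X x' -> G (x', q) <= u x']].

Lemma closure_sphere_compact q0 e :
  compact [set q : yzT R n | closure Q q /\ `|q - q0| = e].
Proof.
have c1 : compact (closed_ball_ Num.norm q0.1 e).
  apply: bounded_closed_compact; last exact: closed_closed_ball_.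
  exists (`|q0.1| + e); split; first exact: num_real.
  move=> M HM y /=; rewrite /closed_ball_/= => H; rewrite (le_trans _ (ltW HM))//.
  by rewrite -[y](subKr q0.1) (le_trans (ler_normB _ _))// lerD2l.
have c2 : compact (closed_ball_ Num.norm q0.2 e).
  apply: (@subclosed_compact _ _ `[q0.2 - e, q0.2 + e]%classic).
  - exact: closed_closed_ball_.
  - exact: segment_compact.
  by move=> z; rewrite /closed_ball_/= in_itv/= ler_norml; lra.
apply: subclosed_compact (compact_setX c1 c2) _.
  apply: (@closedI _ (closure Q) [set q | `|q - q0| = e]);
    first exact: closed_closure.
  apply: (@closed_comp _ _ (fun q : yzT R n => `|q - q0|) [set e]);
    last exact: closed_eq.
  move=> q _; apply: cvg_norm; apply: cvgB; [exact: cvg_id|exact: cvg_cst].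
move=> q [_ /= <-]; rewrite /closed_ball_/= prod_normE/=.
by rewrite !(distrC q0.1) !(distrC q0.2) !le_max !lexx orbT.
Qed.

Definition G_convex_on u := {within X, continuous u} /\
  forall x, X x -> supports u x !=set0.

Lemma near_u u x e : G_convex_on u -> X x -> 0 < e ->
  \forall x' \near x, `|u x - u x'| < e.
Proof.
move=> [cu _] Xx e0; move: cu.
rewrite continuous_open_subspace// => /(_ x); rewrite inE => /(_ Xx).
by move=> /cvgrPdist_lt /(_ e e0).
Qed.

(* Otherwise, the G-segments from q0 to far away supports at nearby points
   cross a fixed compact sphere around q0, and the crossing points cluster at
   another support at x0. *)
Lemma supports_near u x0 q0 e : G_convex_on u -> X x0 -> supports u x0 q0 ->
  (forall q, supports u x0 q -> q = q0) -> 0 < e ->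
  \forall x \near x0, forall q, supports u x q -> `|q - q0| < e.
Proof.
move=> cu Xx0 [Qq0 uq0 leq0] uniq e0.
have cS : compact [set q | closure Q q /\ `|q - q0| = e] by exact: closure_sphere_compact.
(* [P x r] excludes r as a crossing point of a G-segment from q0 to a support at x. By compactness
   of the sphere it is enough to establish it locally, for r' near r and x near x0. *)
pose P x r := ~ [/\ X x, exists2 s, 0 <= s <= 1 &
    G (x, r) = (1 - s) * G (x, q0) + s * u x &
    forall x', X x' -> G (x', r) <= u x'].
have K : \forall x \near x0, [set q | closure Q q /\ `|q - q0| = e] `<=` P x.
  move: cS => /compact_near_coveringP/near_covering_withinP/(_ _ (nbhs x0) P).
  apply.
  move=> r [Qr re].
  have rq0 : r <> q0 by move=> E; move: re e0; rewrite E subrr normr0 => <-;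
    rewrite ltxx.
  (* As r is not a support at x0, either G(., r) exceeds u somewhere, which persists for r' near r,
     or its value at x0 is not u(x0). In the second case a crossing would force G(x, r') to lie
     between G(x, q0) and u(x), both close to u(x0). *)
  have [[x' [Xx' lt]]|NE] := pselect (exists x', X x' /\ u x' < G (x', r)).
    pose eta := G (x', r) - u x'; have eta0 : 0 < eta by rewrite subr_gt0.
    have /near2_distP[d d0 Hd] := near_G C1 Xx' Qr eta0.
    apply/near2_distP; exists d => // r' x r'd xd [Qr' _] [_ _ /(_ x' Xx')].
    have := Hd r' x' r'd; rewrite subrr normr0 => /(_ d0 Xx' Qr')[+ _].
    by rewrite ltr_norml /eta => /andP[_ ?]; lra.
  have /eqP neq : G (x0, r) <> u x0.
    move=> E; apply: rq0; apply: uniq; split => // x' Xx'.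
    by rewrite leNgt; apply/negP => lt; apply: NE; exists x'.
  (* At a crossing, G(x0, r) and u(x0) are each within eta of the same convex combination, hence
     within 2 eta of each other, while their distance is 3 eta. *)
  pose eta := `|G (x0, r) - u x0| / 3.
  have eta0 : 0 < eta by rewrite divr_gt0// normr_gt0 subr_eq0.
  have /near2_distP[d1 d10 H1] := near_G C1 Xx0 Qr eta0.
  have /near2_distP[d2 d20 H2] := near_G C1 Xx0 Qq0 eta0.
  have /near_distP[d3 d30 H3] := near_u cu Xx0 eta0.
  apply/near2_distP; exists (Num.min d1 (Num.min d2 d3)).
    by rewrite !lt_min d10 d20.
  move=> r' x; rewrite !lt_min => /andP[r'1 _] /and3P[x1 x2 x3] [Qr' _].
  move=> [Xx [s /andP[s0 s1] E] _].
  have [A _] := H1 r' x r'1 x1 Xx Qr'.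
  have := H2 q0 x; rewrite subrr normr0 => /(_ d20 x2 Xx Qq0)[+ _]; rewrite -uq0.
  have := H3 x x3; move: A; rewrite E.
  have : `|G (x0, r) - u x0| = eta * 3 by rewrite /eta divfK.
  set a := G (x, q0); set b := u x; set c := u x0; set g := G (x0, r).
  move=> gE A B C.
  have : `|(1 - s) * a + s * b - c| <= eta.
    have -> : (1 - s) * a + s * b - c = (1 - s) * (a - c) + s * (b - c) by lra.
    rewrite (le_trans (ler_normD _ _))// !normrM (ger0_norm s0).
    rewrite ger0_norm ?subr_ge0// (distrC a) (distrC b).
    have : s * `|c - b| <= s * eta by rewrite ler_wpM2l// ltW.
    have : (1 - s) * `|c - a| <= (1 - s) * eta by rewrite ler_wpM2l ?subr_ge0// ltW.
    lra.
  move=> D; have := ler_distD ((1 - s) * a + s * b) g c; rewrite gE.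
  by move: A D eta0; lra.
have nX : \forall x \near x0, X x by exact: open_nbhs_nbhs.
near=> x => q [Qq uq leq].
have Xx : X x by near: x.
rewrite ltNge; apply/negP => le.
have [|s [r [s01 Qr re E H]]] := @G_segment_crossing x q0 q e Xx Qq0 Qq.
  by rewrite le (ltW e0).
have : P x r by apply: (near K x).
apply; split => //; first by exists s; rewrite // uq.
move=> x' Xx'; apply: le_trans (H x' Xx') _; move: s01 => /andP[s0 s1].
have : s * G (x', q) <= s * u x' by rewrite ler_wpM2l// leq.
have : (1 - s) * G (x', q0) <= (1 - s) * u x' by rewrite ler_wpM2l ?subr_ge0// leq0.
lra.
Unshelve. all: by end_near. Qed.

Lemma norm_scale_delta (h : R) (i : 'I_m) : `|h *: (delta_mx 0 i : 'rV[R]_m)| <= `|h|.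
Proof.
apply/rV_norm_le => // j; rewrite !mxE eqxx/=.
by case: eqP => _; rewrite ?mulr1 ?mulr0 ?normr0.
Qed.

(** G(., q) touches u from below at x, so the increments of u dominate those of G(., q), which have
    slope given by G_x up to e. *)
Lemma support_ge u x q i e : X x -> supports u x q -> 0 < e ->
  exists2 d : R, 0 < d & forall h : R, `|h| < d ->
    h * (dG (x, q)).1 0 i - e * `|h| <= u (x + h *: delta_mx 0 i) - u x.
Proof.
move=> Xx [Qq uq leq] e0; have [d d0 Hd] := G_strict_diff oX C1 Xx Qq e0.
have /near_distP[d2 d20 H2] : \forall x' \near x, X x' by exact: open_nbhs_nbhs.
have nd h := norm_scale_delta h i.
exists (Num.min d d2) => [|h]; first by rewrite lt_min d0.
rewrite lt_min => /andP[hd hd2].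
have xh : x + h *: delta_mx 0 i - x = h *: (delta_mx 0 i : 'rV[R]_m).
  by rewrite addrAC subrr add0r.
have := Hd x (x + h *: delta_mx 0 i) q Qq.
rewrite !subrr !normr0 xh dotrV_delta => /(_ d0 d0 (le_lt_trans (nd h) hd)).
have := leq (x + h *: delta_mx 0 i); rewrite uq.
move=> /(_ (H2 _ _)); rewrite xh => /(_ (le_lt_trans (nd h) hd2)).
have := ler_wpM2l (ltW e0) (nd h); rewrite ler_norml.
by move=> A B /andP[C D]; lra.
Qed.

Lemma support_gradient u x q : X x -> differentiable u x -> supports u x q ->
  gradient u x = (dG (x, q)).1.
Proof.
move=> Xx dux sq; apply/rowP => i; rewrite mxE.
apply: derive_eq_of_ge; first exact: diff_derivable.
by move=> e e0; exact: support_ge.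
Qed.

Lemma differentiable_support_unique u x q r : X x -> differentiable u x ->
  supports u x q -> supports u x r -> q = r.
Proof.
move=> Xx dux sq sr; have [Qq uq _] := sq; have [Qr ur _] := sr.
apply: (GxG_inj Xx) => //.
by rewrite /GxG -uq -ur -(support_gradient Xx dux sq) -(support_gradient Xx dux sr).
Qed.

(** The increment u(y) - u(x) is at least that of G(., q) and at most that of G(., r), for any
    support r at y. By [supports_near] r is close to q, so uniform strict differentiability gives
    both bounds the same linear part. *)
Lemma support_unique_differentiable u x q : G_convex_on u -> X x ->
  supports u x q -> (forall r, supports u x r -> r = q) -> differentiable u x.
Proof.
move=> cu Xx sq uniq; have [Qq uq leq] := sq.
apply: (differentiable_near_le (df := dotrV (dG (x, q)).1)).
  exact: dotrV_continuous.
move=> e e0; have [d d0 Hd] := G_strict_diff oX C1 Xx Qq e0.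
have /near_distP[d1 d10 H1] : \forall x' \near x, X x' by exact: open_nbhs_nbhs.
have /near_distP[d2 d20 H2] := supports_near cu Xx sq uniq d0.
exists (Num.min d (Num.min d1 d2)) => [|y]; first by rewrite !lt_min d0 d10.
rewrite !lt_min => /and3P[yd yd1 yd2].
have Xy := H1 y yd1; have [_ /(_ y Xy)[r sr]] := cu.
have := H2 y yd2 r sr; have [Qr ur ler] := sr => rq.
have := Hd x y r Qr rq; rewrite subrr normr0 => /(_ d0 yd).
have := Hd x y q Qq; rewrite !subrr !normr0 => /(_ d0 d0 yd).
have := leq y Xy; have := ler x Xx; rewrite ur uq !ler_norml.
set w := dotrV _ _; set E := e * _ => A B /andP[C1' C2'] /andP[D1 D2].
by apply/andP; split; lra.
Qed.

(** A support at x solves the two equations defining ybarG, so [get] does not return its default,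
    and injectivity in (G1) identifies the two. *)
Lemma ybarG_support u x : G_convex_on u -> X x -> differentiable u x ->
  supports u x (ybarG G dG (closure Q) x (u x) (gradient u x)).
Proof.
move=> cu Xx dux; have [_ /(_ x Xx)[q sq]] := cu.
rewrite /ybarG; set S := [set q | _].
have Sq : S q by have [Qq uq _] := sq; split => //; exact: support_gradient.
have [Qy uy gy] := getI Sq; suff -> : get S = q by [].
apply: (GxG_inj Xx) => //; first by have [] := sq.
by have [_ uq _] := sq; rewrite /GxG -uy -gy -uq (support_gradient Xx dux sq).
Qed.

Lemma supports_conv u0 u1 x q0 q1 (q : R -> yzT R n) t : X x ->
  G_segment G dG (closure Q) x q0 q1 q -> supports u0 x q0 -> supports u1 x q1 ->
  0 <= t <= 1 -> supports ((1 - t) *: u0 + t *: u1) x (q t).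
Proof.
move=> Xx Sq [Q0 e0 le0] [Q1 e1 le1] t01; have [_ _ /(_ t t01)[Qt Et]] := Sq.
split => //.
  by rewrite !fctE e0 e1; have /= := congr1 snd Et => ->.
move=> x' Xx'; apply: le_trans (G_segment_le Xx' Xx Sq t01) _.
rewrite !fctE; move: t01 => /andP[t0 t1].
by apply: lerD; apply: ler_wpM2l; rewrite ?subr_ge0//; [exact: le0|exact: le1].
Qed.

Lemma G_convex_on_conv u0 u1 t : G_convex_on u0 -> G_convex_on u1 ->
  0 <= t <= 1 -> G_convex_on ((1 - t) *: u0 + t *: u1).
Proof.
move=> cu0 cu1 t01; split.
  rewrite continuous_open_subspace// => x; rewrite inE => Xx.
  have [+ _] := cu0; have [+ _] := cu1; rewrite !continuous_open_subspace//.
  move=> /(_ x); rewrite inE => /(_ Xx) c1 /(_ x); rewrite inE => /(_ Xx) c0.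
  by apply: (@cvgD _ _ _ (nbhs x)); apply: cvgZl_tmp; [exact: c0|exact: c1].
move=> x Xx; have [_ /(_ x Xx)[q0 s0]] := cu0; have [_ /(_ x Xx)[q1 s1]] := cu1.
have [q Sq _] := G_segment_exists Xx (let: And3 h _ _ := s0 in h) (let: And3 h _ _ := s1 in h).
by exists (q t); exact: supports_conv Sq s0 s1 t01.
Qed.

Lemma G_supports x q : closure Q q -> supports (fun x => G (x, q)) x q.
Proof. by split. Qed.

Lemma G_convex_on_G q : closure Q q -> G_convex_on (fun x => G (x, q)).
Proof.
move=> Qq; split; last by move=> x Xx; exists q; exact: G_supports.
rewrite continuous_open_subspace// => x; rewrite inE => Xx.
apply/(@cvgrPdist_lt _ _ _ _ (nbhs_filter x)) => e e0.
have /near2_distP[d1 d10 H1] := near_G C1 Xx Qq e0.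
have /near_distP[d2 d20 H2] : \forall x' \near x, X x' by exact: open_nbhs_nbhs.
apply/(@near_distP R 'rV[R]_m x); exists (Num.min d1 d2).
  by rewrite lt_min d10.
move=> y; rewrite lt_min => /andP[y1 /H2 Xy].
by have := H1 q y; rewrite subrr normr0 => /(_ d10 y1 Xy Qq)[].
Qed.

(* Near a kink in the direction of the i-th axis the difference quotients of u
   are at most a on the left and at least b on the right, at a fixed scale; the
   bound on the i-th coordinate leaves room for one kink on each line. *)
Definition kinks u (i : 'I_m) (a b : rat) (k : nat) (c : rat) : set 'rV[R]_m :=
  [set x | [/\ forall y, `|y - x| < k.+1%:R^-1 -> X y,
    `|x 0 i - ratr c| <= k.+1%:R^-1 / 4 &
    forall h, 0 < h < k.+1%:R^-1 ->
      ratr b * h <= u (x + h *: delta_mx 0 i) - u x /\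
      - (ratr a * h) <= u (x - h *: delta_mx 0 i) - u x]].

Lemma kinks_sub u i a b k c : kinks u i a b k c `<=` X.
Proof.
by move=> x [/(_ x) H _ _]; apply: H; rewrite subrr normr0 invr_gt0.
Qed.

(** The open-ball condition passes to the limit, since a point of the ball around x lies in the ball
    around any kink close enough to x. It keeps x + w in X for short w, so u is continuous there and
    the non-strict inequalities pass to the limit as well. *)
Lemma closed_kinks u i a b k c : G_convex_on u -> closed (kinks u i a b k c).
Proof.
move=> cu x cx; have cE e : 0 < e -> exists2 y, kinks u i a b k c y & `|y - x| < e.
  by move=> e0; have [|y [? ?]] := cx [set y | `|y - x| < e];
    [by apply/(@near_distP R 'rV[R]_m x); exists e|exists y].
have XX : forall y, `|y - x| < k.+1%:R^-1 -> X y.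
  move=> y yx; have [|z [Hz _ _] zx] := cE (k.+1%:R^-1 - `|y - x|).
    by rewrite subr_gt0.
  apply: Hz; rewrite -(subrKA x) (le_lt_trans (ler_normD _ _))//.
  by rewrite (distrC x) addrC -ltrBrDr.
have uE w e : `|w| < k.+1%:R^-1 -> 0 < e ->
    \forall y \near x, `|u (x + w) - u (y + w)| < e.
  move=> wk e0; have Xw : X (x + w) by apply: XX; rewrite addrAC subrr add0r.
  have /near_distP[d d0 Hd] := near_u cu Xw e0.
  by apply/(@near_distP R 'rV[R]_m x); exists d => // y yx; apply: Hd;
    rewrite opprD addrACA subrr addr0.
split => //.
  apply/ler_addgt0Pr => e e0; have [z [_ Hz _] zx] := cE e e0.
  have := rV_coord_le (z - x) i; rewrite !mxE => H.
  rewrite -(subrKA (z 0 i)) (le_trans (ler_normD _ _))// addrC lerD//.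
  by rewrite distrC (le_trans H)// ltW.
move=> h /andP[h0 hk].
have hE (w : 'rV[R]_m) (v : R) : `|w| < k.+1%:R^-1 ->
   (forall y, kinks u i a b k c y -> v <= u (y + w) - u y) -> v <= u (x + w) - u x.
  move=> wk H; apply/ler_addgt0Pr => e e0; have e20 : 0 < e / 2 by rewrite divr_gt0.
  have /near_distP[d1 d10 H1] := uE w _ wk e20.
  have w0 : `|0 : 'rV[R]_m| < k.+1%:R^-1 by rewrite normr0 invr_gt0.
  have /near_distP[d2 d20 H2] := uE 0 _ w0 e20.
  have [|z Hz zx] := cE (Num.min d1 d2); first by rewrite lt_min d10.
  move: zx; rewrite lt_min => /andP[/H1 + /H2]; have := H z Hz.
  by rewrite !addr0 !ltr_norml => A /andP[? ?] /andP[? ?]; lra.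
have hd : `|h *: (delta_mx 0 i : 'rV[R]_m)| < k.+1%:R^-1.
  by rewrite (le_lt_trans (norm_scale_delta _ _))// gtr0_norm.
split; apply: hE; rewrite ?normrN//.
  by move=> y [_ _ /(_ h)]; rewrite h0 => /(_ hk)[].
by move=> y [_ _ /(_ h)]; rewrite h0 => /(_ hk)[].
Qed.

(** Two kinks x and y = x + h e_i with h > 0 would give b h <= u(y) - u(x) <= a h, by the right
    quotient at x and the left quotient at y. *)
Lemma kinks_graph u i a b k c x y : a < b ->
  kinks u i a b k c x -> kinks u i a b k c y ->
  (forall j, j != i -> x 0 j = y 0 j) -> x 0 i = y 0 i.
Proof.
move=> ab; wlog xy : x y / x 0 i <= y 0 i.
  move=> W Kx Ky H; have [xy|/ltW xy] := leP (x 0 i) (y 0 i); first exact: W.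
  by apply/esym; apply: W => // j /H.
move=> [_ cx Hx] [_ cy Hy] H; apply/eqP; move: xy.
rewrite le_eqVlt => /orP[//|xy]; exfalso.
pose h := y 0 i - x 0 i; have h0 : 0 < h by rewrite subr_gt0.
have k0 : 0 < k.+1%:R^-1 :> R by rewrite invr_gt0.
(* Both coordinates are within a quarter of the scale from c, so h is at most half of the scale. *)
have hk : h < k.+1%:R^-1.
  by move: cx cy k0; rewrite /h !ler_norml; set K := k.+1%:R^-1; lra.
have yE : y = x + h *: delta_mx 0 i.
  apply/rowP => j; rewrite !mxE eqxx/=; have [->|/H ->] := eqVneq j i.
    by rewrite mulr1 addrC subrK.
  by rewrite mulr0 addr0.
have h0k : 0 < h < k.+1%:R^-1 by rewrite h0.
have [+ _] := Hx h h0k; rewrite -yE.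
have [_ +] := Hy h h0k; rewrite {1}yE addrK.
have : ratr a < ratr b :> R by rewrite ltr_rat.
by rewrite -(ltr_pM2r h0); lra.
Qed.

(** Two distinct supports at x share the value u(x), so by (G1) their gradients differ in some
    coordinate i; rationals a < b strictly between these slopes give the kink. All parameters are
    countable, which the measurability and null set arguments require. *)
Lemma not_differentiable_kinks u x : G_convex_on u -> X x ->
  ~ differentiable u x <->
  exists i a b k c, a < b /\ kinks u i a b k c x.
Proof.
move=> cu Xx; split; last first.
  move=> [i [a [b [k [c [ab [_ _ H]]]]]]] du.
  have abR : ratr a < ratr b :> R by rewrite ltr_rat.
  (* With error e the derivative D would satisfy b - e <= D <= a + e, so b - a <= 2 e, which e = (b
     - a) / 4 excludes. *)
  have e0 : 0 < (ratr b - ratr a) / 4 :> R by rewrite divr_gt0// subr_gt0.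
  have [d d0 Hd] := derivable_near_le (@diff_derivable _ _ _ _ _ (delta_mx 0 i) du) e0.
  pose h : R := Num.min d k.+1%:R^-1 / 2.
  have k0 : 0 < k.+1%:R^-1 :> R by rewrite invr_gt0.
  have hdk : 0 < h /\ h < Num.min d k.+1%:R^-1.
    have : 0 < Num.min d k.+1%:R^-1 by rewrite lt_min d0.
    by rewrite /h; set w := Num.min _ _; lra.
  move: hdk => [h0]; rewrite lt_min => /andP[hd hk].
  have [|A B] := H h; first by rewrite h0.
  have := Hd h; rewrite gtr0_norm// => /(_ hd).
  have := Hd (- h); rewrite normrN gtr0_norm// scaleNr => /(_ hd).
  rewrite !ler_norml; set D := 'D_ _ _ _ => /andP[C1' C2'] /andP[D1 D2].
  have : 0 < (ratr b - ratr a) * h :> R by rewrite mulr_gt0// subr_gt0.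
  by lra.
move=> ndu; have [_ /(_ x Xx)[q sq]] := cu.
have [r sr rq] : exists2 r, supports u x r & r <> q.
  apply: contrapT => NE; apply: ndu; apply: support_unique_differentiable sq _ => //.
  by move=> r sr; apply: contrapT => ?; apply: NE; exists r.
have : exists i, (dG (x, q)).1 0 i != (dG (x, r)).1 0 i.
  apply: contrapT => NE; apply: rq; have [Qq uq _] := sq; have [Qr ur _] := sr.
  apply: (GxG_inj Xx) => //; rewrite /GxG -uq -ur; congr (_, _).
  by apply/rowP => i; apply/eqP; apply: contraT; rewrite eq_sym => ?; exfalso;
    apply: NE; exists i.
move=> [i]; rewrite neq_lt.
wlog lt : q r sq sr rq / (dG (x, q)).1 0 i < (dG (x, r)).1 0 i.
  move=> W /orP[lt|lt]; first by apply: (W q r) => //; rewrite lt.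
  by apply: (W r q) => //; [exact/nesym|rewrite lt].
move=> _; have [a] := rat_in_itvoo lt; rewrite in_itv/= => /andP[a1 a2].
have [b] := rat_in_itvoo a2; rewrite in_itv/= => /andP[b1 b2].
(* The allowed error is the room between a and the slope of q, and between b and the slope of r. *)
have [e e0 [ea eb]] : exists2 e : R, 0 < e & e <= ratr a - (dG (x, q)).1 0 i /\
    e <= (dG (x, r)).1 0 i - ratr b.
  exists (Num.min (ratr a - (dG (x, q)).1 0 i) ((dG (x, r)).1 0 i - ratr b)).
    by rewrite lt_min !subr_gt0 a1.
  by rewrite !ge_min !lexx orbT.
have [d1 d10 H1] := support_ge i Xx sq e0.
have [d2 d20 H2] := support_ge i Xx sr e0.
have /near_distP[d3 d30 H3] : \forall x' \near x, X x' by exact: open_nbhs_nbhs.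
have [k] : exists k : nat, k.+1%:R^-1 < Num.min d1 (Num.min d2 d3).
  have d0 : 0 < Num.min d1 (Num.min d2 d3) by rewrite !lt_min d10 d20.
  exists (Num.trunc (Num.min d1 (Num.min d2 d3))^-1).
  rewrite invf_plt ?posrE//.
  exact: truncnS_gt.
rewrite !lt_min => /and3P[k1 k2 k3].
have k0 : 0 < k.+1%:R^-1 :> R by rewrite invr_gt0.
have [c] : exists c : rat, ratr c \in `]x 0 i - k.+1%:R^-1 / 4, x 0 i + k.+1%:R^-1 / 4[.
  have [|c] := @rat_in_itvoo R (x 0 i - k.+1%:R^-1 / 4) (x 0 i + k.+1%:R^-1 / 4).
    by move: k0; set K := k.+1%:R^-1; lra.
  by exists c.
rewrite in_itv/= => /andP[c1 c2].
exists i, a, b, k, c; split; first by rewrite -(@ltr_rat R).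
split.
- by move=> y yx; apply: H3; exact: lt_trans k3.
- by rewrite ler_norml; move: c1 c2; set K := k.+1%:R^-1; lra.
move=> h /andP[h0 hk]; split.
  have := H2 h; rewrite gtr0_norm// => /(_ (lt_trans hk k2)).
  have : e * h <= ((dG (x, r)).1 0 i - ratr b) * h by rewrite ler_wpM2r// ltW.
  by lra.
have := H1 (- h); rewrite normrN gtr0_norm// scaleNr => /(_ (lt_trans hk k1)).
have : e * h <= (ratr a - (dG (x, q)).1 0 i) * h by rewrite ler_wpM2r// ltW.
by lra.
Qed.

End GConvexity.

(** * Lebesgue null sets *)

Section LebesgueNull.
Context {R : realType} {m : nat}.
Implicit Types (A B E : set 'rV[R]_m) (a b : 'rV[R]_m).

Definition box a b : set 'rV[R]_m := [set x | forall i, a 0 i <= x 0 i <= b 0 i].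

Definition volume a b : R := \prod_i (b 0 i - a 0 i).

Lemma volume_ge0 a b : (forall i, a 0 i <= b 0 i) -> 0 <= volume a b.
Proof. by move=> ab; apply: prodr_ge0 => i _; rewrite subr_ge0. Qed.

Lemma lebesgueRV_ge0 A : (0 <= @lebesgueRV R m A)%E.
Proof.
apply: le_ereal_inf_tmp => _ [a [b [ab _ ->]]].
by apply: nneseries_ge0 => k _ _; rewrite lee_fin volume_ge0.
Qed.

Lemma le_lebesgueRV A B : A `<=` B -> (@lebesgueRV R m A <= @lebesgueRV R m B)%E.
Proof.
move=> AB; apply: ereal_inf_le_tmp => s [a [b [ab BE ->]]].
by exists a, b; split => //; exact: subset_trans BE.
Qed.

Lemma lebesgueRV_finite_cover A (T : eqType) (s : seq T) (c0 : T)
    (a b : T -> 'rV[R]_m) : (0 < m)%N ->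
  (forall c i, a c 0 i <= b c 0 i) ->
  (forall x, A x -> exists2 c, c \in s & box (a c) (b c) x) ->
  (@lebesgueRV R m A <= (\sum_(c <- s) volume (a c) (b c))%:E)%E.
Proof.
move=> m0 ab AE; apply: ereal_inf_lbound.
(* The finite family is continued by boxes reduced to the origin, whose volume is 0 because m > 0;
   for m = 0 the empty product would be 1. *)
pose ext (f : T -> 'rV[R]_m) k := if (k < size s)%N then f (nth c0 s k) else 0.
exists (ext a), (ext b); split.
- by move=> k i; rewrite /ext; case: ifP.
- move=> x /AE[c cs cx]; exists (index c s) => //.
  by rewrite /= /ext index_mem cs nth_index.
rewrite (nneseries_split 0 (size s)); last first.
  by move=> k _; rewrite lee_fin volume_ge0// => i; rewrite /ext; case: ifP.
rewrite [X in (_ + X)%E]eseries0 ?adde0; last first.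
  move=> k; rewrite add0n => sk _; rewrite /ext ltnNge sk /=.
  by congr EFin; rewrite (bigD1 (Ordinal m0))//= subrr mul0r.
rewrite add0n sumEFin; congr EFin; rewrite (big_nth c0) !big_nat.
by apply: eq_bigr => k /andP[_ ks]; rewrite /ext ks.
Qed.

Lemma grid_cell (s y : R) N : 0 <= y <= s * N.+1%:R ->
  exists k : 'I_N.+1, s * k%:R <= y <= s * k%:R + s.
Proof.
elim: N => [|N IH] /andP[y0 yN].
  by exists ord0; rewrite /= mulr0 add0r y0 (le_trans yN)// mulr1.
have [ys|/ltW ys] := leP y (s * N.+1%:R).
  have [|k Hk] := IH; first by rewrite y0.
  by exists (widen_ord (leqnSn _) k).
by exists ord_max; rewrite /= ys (le_trans yN)// -[N.+2]addn1 natrD mulrDr mulr1.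
Qed.

(** This is uniform continuity of the function whose graph is E. The pairs in E with i-th
    coordinates at least eta apart form a compact set; each has another coordinate in which it
    differs, and compactness makes that difference uniform. *)
Lemma graph_modulus E i (eta : R) : compact E ->
  (forall x y, E x -> E y -> (forall j, j != i -> x 0 j = y 0 j) -> x 0 i = y 0 i) ->
  0 < eta -> exists2 rho : R, 0 < rho & forall x y, E x -> E y ->
    (forall j, j != i -> `|x 0 j - y 0 j| <= rho) -> `|x 0 i - y 0 i| <= eta.
Proof.
move=> cE gE eta0.
pose K : set ('rV[R]_m * 'rV[R]_m) := (E `*` E) `&` [set p : 'rV[R]_m * 'rV[R]_m | eta <= `|p.1 0 i - p.2 0 i|].
have cK : compact K.
  apply: compact_closedI; first exact: compact_setX.
  apply: (@closed_comp _ _ (fun p : 'rV[R]_m * 'rV[R]_m => `|p.1 0 i - p.2 0 i|) [set t | eta <= t]).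
    move=> p _; apply: cvg_norm; apply: cvgB.
      by apply: (@cvg_comp _ _ _ fst (fun x : 'rV[R]_m => x 0 i));
        [exact: cvg_fst|exact: coord_continuous].
    by apply: (@cvg_comp _ _ _ snd (fun x : 'rV[R]_m => x 0 i));
      [exact: cvg_snd|exact: coord_continuous].
  exact: closed_ge.
pose P (rho : R) (p : 'rV[R]_m * 'rV[R]_m) :=
  ~ (forall j, j != i -> `|p.1 0 j - p.2 0 j| <= rho).
have near0 : \forall rho \near (0 : R), K `<=` P rho.
  move: cK => /compact_near_coveringP/(_ _ (nbhs (0 : R)) P); apply.
  move=> [x y] [[/= Ex Ey] etaxy].
  have : exists2 j, j != i & x 0 j != y 0 j.
    apply: contrapT => NE; have : x 0 i = y 0 i.
      apply: gE => // j ji; apply/eqP; apply: contraT => ?; exfalso.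
      by apply: NE; exists j.
    by move=> xy; move: etaxy eta0; rewrite xy subrr normr0; lra.
  move=> [j ji xyj]; pose d := `|x 0 j - y 0 j| / 3.
  have d0 : 0 < d by rewrite divr_gt0// normr_gt0 subr_eq0.
  apply/near2_distP; exists d => // -[x' y'] rho /=.
  rewrite [`|_ - _|]prod_normE/= gt_max subr0 => /andP[xx' yy'] rd /(_ j ji).
  have := rV_coord_le (x' - x) j; have := rV_coord_le (y' - y) j; rewrite !mxE.
  have := ler_norm rho; have : `|x 0 j - y 0 j| = d * 3 by rewrite /d divfK.
  have := ler_distD (x' 0 j) (x 0 j) (y 0 j).
  have := ler_distD (y' 0 j) (x' 0 j) (y 0 j).
  rewrite (distrC (x 0 j) (x' 0 j)); lra.
move: near0 => /near_distP[d d0 Hd]; exists (d / 2); first by rewrite divr_gt0.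
move=> x y Ex Ey H; rewrite leNgt; apply/negP => /ltW lt.
have : P (d / 2) (x, y).
  by apply: Hd => //; rewrite subr0 gtr0_norm ?divr_gt0//; lra.
by apply; exact: H.
Qed.

(** The coordinates other than i are cut into cells of side s at most the modulus rho. Above each
    cell E fits in a slab of height 2 eta, so the total volume is 2 eta (2 L)^(m-1). *)
Lemma lebesgueRV_graph E i : compact E ->
  (forall x y, E x -> E y -> (forall j, j != i -> x 0 j = y 0 j) -> x 0 i = y 0 i) ->
  @lebesgueRV R m E = 0%E.
Proof.
move=> cE gE; apply/eqP; rewrite eq_le lebesgueRV_ge0 andbT.
have m0 : (0 < m)%N by exact: leq_ltn_trans (ltn_ord i).
have [L L0 EL] : exists2 L : R, 0 <= L & forall x j, E x -> `|x 0 j| <= L.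
  have [M [_ HM]] := compact_bounded cE.
  exists (`|M| + 1); first by rewrite addr_ge0.
  move=> x j Ex; apply: le_trans (rV_coord_le x j) _; apply: HM => //.
  by rewrite (le_lt_trans (ler_norm _))// ltrDl.
apply/lee_addgt0Pr => e e0; rewrite add0e.
pose C := (L + L) ^+ m.-1; have C0 : 0 <= C by rewrite exprn_ge0// addr_ge0.
(* Chosen so that 2 eta C <= e; adding 1 keeps the divisor positive. *)
pose eta := e / (C + 1) / 2.
have eta0 : 0 < eta by rewrite !divr_gt0// ltr_wpDl.
have [rho rho0 Hrho] := graph_modulus cE gE eta0.
pose N := Num.trunc ((L + L) / rho).
pose s := (L + L) / N.+1%:R.
have s0 : 0 <= s by rewrite divr_ge0// addr_ge0.
have sN : s * N.+1%:R = L + L by rewrite divfK.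
have srho : s <= rho.
  rewrite ler_pdivrMr// mulrC -ler_pdivrMr//.
  by apply: ltW; exact: truncnS_gt.
pose cell (c : {ffun 'I_m -> 'I_N.+1}) (x : 'rV[R]_m) := forall j, j != i ->
  - L + s * (c j)%:R <= x 0 j <= - L + s * (c j)%:R + s.
(* The default 0 is taken when E has no point above the cell; such a cell is never the one selected
   for a point of E. *)
pose z c := (xget 0 [set x | E x /\ cell c x]) 0 i.
(* The functions c also carry an index at i. Only the value [ord0] there yields a slab of height 2
   eta; the other values yield boxes of zero width, so each cell counts once. *)
pose lo (c : {ffun 'I_m -> 'I_N.+1}) : 'rV[R]_m := \row_j (if j == i
  then if c i == ord0 then z c - eta else 0 else - L + s * (c j)%:R).
pose hi (c : {ffun 'I_m -> 'I_N.+1}) : 'rV[R]_m := \row_j (if j == i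
  then if c i == ord0 then z c + eta else 0 else - L + s * (c j)%:R + s).
pose w (j : 'I_m) (k : 'I_N.+1) := if j == i
  then if k == ord0 then eta + eta else 0 else s.
have volE c : volume (lo c) (hi c) = \prod_j w j (c j).
  apply: eq_bigr => j _; rewrite !mxE /w; case: eqP => [->|_].
    by case: ifP => _; [move: (z c) => t; lra|rewrite subrr].
  by rewrite addrAC subrr add0r.
have tot : \sum_(c : {ffun 'I_m -> 'I_N.+1}) volume (lo c) (hi c) = (eta + eta) * C.
  (* The sum over c of a product factors into a product of sums: 2 eta for the coordinate i and s (N
     + 1) = 2 L for each other one. *)
  rewrite (eq_bigr _ (fun c _ => volE c)) -bigA_distr_bigA/=.
  rewrite (bigD1 i)//= {1}/w eqxx big_ord_recl/= big1 ?addr0//; congr (_ * _).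
  rewrite (eq_bigr (fun=> L + L)); last first.
    move=> j ji; rewrite /w (negbTE ji) sumr_const card_ord -mulr_natr.
    by rewrite sN.
  by rewrite prodr_const cardC1 card_ord.
have le_e : (eta + eta) * C <= e.
  by rewrite -splitr mulrAC ler_pdivrMr ?ltr_wpDl// ler_wpM2l// ?ltW// ltrDl.
apply: le_trans (_ : ((eta + eta) * C)%:E <= _)%E; last by rewrite lee_fin.
rewrite -tot; apply: lebesgueRV_finite_cover => //.
- exact: [ffun=> ord0].
- move=> c j; rewrite !mxE; case: eqP => _; last by rewrite lerDl.
  by case: ifP => // _; lra.
move=> x Ex.
have cellP j : exists k : 'I_N.+1, - L + s * k%:R <= x 0 j <= - L + s * k%:R + s.
  have := EL x j Ex; rewrite ler_norml => /andP[x1 x2].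
  have [|k] := @grid_cell s (x 0 j + L) N; first by rewrite sN; lra.
  by move=> Hk; exists k; lra.
pose c := [ffun j => if j == i then ord0 else sval (cid (cellP j))].
have cx : cell c x.
  by move=> j ji; rewrite /c ffunE (negbTE ji); case: cid.
exists c; first by rewrite mem_index_enum.
move=> j; rewrite !mxE; have [->|ji] := eqVneq j i; last exact: cx.
rewrite {1 3}/c !ffunE eqxx eqxx.
rewrite -ler_distlC /z; case: xgetP => [y _ [Ey cy]|/(_ x)[]//].
rewrite distrC; apply: Hrho => // k ki; apply: le_trans srho.
by have := cx k ki; have := cy k ki; rewrite ler_norml; lra.
Qed.

End LebesgueNull.

(** * Borel sets and uniform distributions *)

Lemma bigcup_countType (I : countType) (T : Type) (F : I -> set T) :
  \bigcup_i F i = \bigcup_(k : nat) oapp F set0 (unpickle k).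
Proof.
apply/seteqP; split => [x [i _ Fix]|x [k _]].
  by exists (pickle i) => //=; rewrite pickleK.
by case: unpickle => //= i Fix; exists i.
Qed.

Lemma measurable_bigcup_countType (I : countType) d (T : measurableType d)
    (F : I -> set T) : (forall i, measurable (F i)) -> measurable (\bigcup_i F i).
Proof.
move=> mF; rewrite bigcup_countType; apply: bigcup_measurable => k _.
by case: unpickle => //= i.
Qed.

Lemma measure_bigcup_countType0 (I : countType) d (T : measurableType d)
    (R : realType) (mu : {measure set T -> \bar R}) (F : I -> set T) :
  (forall i, measurable (F i)) -> (forall i, mu (F i) = 0%E) ->
  mu (\bigcup_i F i) = 0%E.
Proof.
move=> mF F0; apply/eqP; rewrite eq_le measure_ge0 andbT bigcup_countType.
apply: le_trans (measure_sigma_subadditive _ (fun k => _) _ (@subset_refl _ _)) _.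
- by move=> k; case: unpickle => //= i.
- rewrite -bigcup_countType; exact: measurable_bigcup_countType.
rewrite eseries0// => k _ _; case: unpickle => //=; exact: measure0.
Qed.

Section BorelRV.
Context {R : realType}.

Lemma open_measurableRV m (A : set (borelRV R m)) :
  open (A : set 'rV[R]_m) -> measurable A.
Proof. exact: sub_sigma_algebra. Qed.

Lemma closed_measurableRV m (A : set (borelRV R m)) :
  closed (A : set 'rV[R]_m) -> measurable A.
Proof.
by move=> cA; rewrite -[A]setCK; apply: measurableC; apply: open_measurableRV;
  exact: closed_openC.
Qed.

(** Boxes with rational corners are countably many, so this lets measurability into the Borel sets
    of R^m be tested on coordinates. *)
Lemma open_bigcup_rat_box m (U : set 'rV[R]_m) : open U ->
  exists I : set ('rV[rat]_m * 'rV[rat]_m), U = \bigcup_(p in I)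
    [set x : 'rV[R]_m | forall i, ratr (p.1 0 i) < x 0 i < ratr (p.2 0 i)].
Proof.
move=> oU.
exists [set p : 'rV[rat]_m * 'rV[rat]_m | [set x : 'rV[R]_m | forall i,
   ratr (p.1 0 i) < x 0 i < ratr (p.2 0 i)] `<=` U].
apply/seteqP; split => [x Ux|x [p /= pU px]]; last exact: pU.
have /near_distP[d d0 Hd] : \forall y \near x, U y by exact: open_nbhs_nbhs.
have lo i : exists q : rat, x 0 i - d < ratr q < x 0 i.
  by have [|q] := @rat_in_itvoo R (x 0 i - d) (x 0 i); [lra|rewrite in_itv/=;
    exists q].
have hi i : exists q : rat, x 0 i < ratr q < x 0 i + d.
  by have [|q] := @rat_in_itvoo R (x 0 i) (x 0 i + d); [lra|rewrite in_itv/=;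
    exists q].
exists (\row_i sval (cid (lo i)), \row_i sval (cid (hi i))) => /=.
  move=> y /= Hy; apply: Hd; apply/rV_norm_lt => // i.
  have := Hy i; rewrite !mxE; case: cid => a /=; case: cid => b /=.
  by rewrite ltr_norml; lra.
by move=> i; rewrite !mxE; case: cid => a /=; case: cid => b /=; lra.
Qed.

Lemma measurable_fun_rV d (T : measurableType d) m (f : T -> borelRV R m) :
  (forall i, measurable_fun setT (fun t => (f t : 'rV[R]_m) 0 i)) ->
  measurable_fun setT f.
Proof.
move=> mf;
  apply: (measurability (rT := borelRV R m) (@open 'rV[R]_m)) => // _ [U oU <-].
rewrite setTI; have [J ->] := open_bigcup_rat_box oU.
rewrite preimage_bigcup bigcup_mkcond; apply: measurable_bigcup_countType => p.
case: ifP => // _.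
rewrite [X in measurable X](_ : _ = \bigcap_(i in [set: 'I_m])
    ((fun t => (f t : 'rV[R]_m) 0 i) @^-1` `]ratr (p.1 0 i), ratr (p.2 0 i)[%classic)).
  by apply: fin_bigcap_measurable => // i _; rewrite -[X in measurable X]setTI;
    exact: mf.
apply/seteqP; split => [t /= Ht i _|t Ht i]; first by rewrite /= in_itv/=.
by have := Ht i I; rewrite /= in_itv.
Qed.

Lemma within_continuous_measurable m (D : set (borelRV R m)) (f : 'rV[R]_m -> R) :
  measurable D -> {within (D : set 'rV[R]_m), continuous f} ->
  measurable_fun D (f : borelRV R m -> R).
Proof.
move=> mD /continuousP cf; apply: (measurability _ (RGenOpens.measurableE R)).
move=> _ [_ [a [b ->] <-]].
have /cf/open_subspaceP[V oV VE] : open (`]a, b[%classic : set R) by exact: interval_open.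
by rewrite setIC -VE; apply: measurableI => //; exact: open_measurableRV.
Qed.

Lemma measurable_coord m i :
  measurable_fun setT (fun v : borelRV R m => (v : 'rV[R]_m) 0 i).
Proof.
apply: (within_continuous_measurable (f := fun v : 'rV[R]_m => v 0 i)) => //.
by apply: continuous_subspaceT => v; exact: coord_continuous.
Qed.

Lemma measurable_box m (a b : 'rV[R]_m) : measurable (box a b : set (borelRV R m)).
Proof.
rewrite [X in measurable X](_ : _ = \bigcap_(i in [set: 'I_m])
    ((fun v : borelRV R m => (v : 'rV[R]_m) 0 i) @^-1` `[a 0 i, b 0 i]%classic)).
  by apply: fin_bigcap_measurable => // i _; rewrite -[X in measurable X]setTI;
    exact: measurable_coord.
apply/seteqP; split => [t /= Ht i _|t Ht i]; first by rewrite /= in_itv/=.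
by have := Ht i I; rewrite /= in_itv.
Qed.

Lemma uniform_prob_itv_le (a b : R) (ab : a < b) (c d : R) : c <= d ->
  (uniform_prob ab `[c, d]%classic <= ((d - c) / (b - a))%:E)%E.
Proof.
move=> cd; rewrite /uniform_prob.
apply: le_trans (_ : \int[lebesgue_measure]_(x in `[c, d]) (cst (b - a)^-1%:E x) <= _)%E.
  apply: ge0_le_integral => //.
  - by move=> x _; rewrite lee_fin uniform_pdf_ge0.
  - by apply/measurable_EFinP; apply: measurable_funTS;
    exact: measurable_uniform_pdf.
  - move=> x _; rewrite lee_fin /uniform_pdf; case: ifP => // _.
    by rewrite invr_ge0 subr_ge0 ltW.
rewrite integral_cst//= lebesgue_measure_itv/= lte_fin.
case: ltP => [_|dc]; first by rewrite -EFinB -EFinM mulrC.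
by rewrite mule0 lee_fin divr_ge0// subr_ge0// ltW.
Qed.

(** By induction on the dimension: the law on R^(m+1) is the image of the product of a
    one-dimensional uniform law and the law on R^m under the map [f] that prepends a coordinate. The
    bound on boxes is what yields absolute continuity. *)
Lemma uniform_box_exists (r : R) : 0 < r -> forall m (c : 'rV[R]_m),
  exists P : probability (borelRV R m) R,
    P (box (c - const_mx r) (c + const_mx r)) = 1%E /\
    forall a b : 'rV[R]_m, (forall i, a 0 i <= b 0 i) ->
      (P (box a b) <= (volume a b / (r + r) ^+ m)%:E)%E.
Proof.
move=> r0; elim=> [|m IH] c.
  (* In dimension 0 the law is the point mass, and the empty product gives every box volume 1. *)
  exists \d_(0 : borelRV R 0); split; first by rewrite /= diracE mem_set// => -[].
  move=> a b _; rewrite /volume big_ord0 expr0 divr1; apply: probability_le1.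
  exact: measurable_box.
pose hd (a : 'rV[R]_m.+1) := a 0 ord0.
pose tl (a : 'rV[R]_m.+1) : 'rV[R]_m := \row_i a 0 (lift ord0 i).
have [P [P1 Pbox]] := IH (tl c).
have ab : c 0 ord0 - r < c 0 ord0 + r by lra.
pose f (p : measurableTypeR R * borelRV R m) : borelRV R m.+1 :=
  \row_j (if unlift ord0 j is Some k then (p.2 : 'rV[R]_m) 0 k else p.1).
have mf : measurable_fun setT f.
  apply: measurable_fun_rV => j.
  rewrite (_ : (fun _ => _) = (fun p : measurableTypeR R * borelRV R m =>
    if unlift ord0 j is Some k then (p.2 : 'rV[R]_m) 0 k else p.1)); last first.
    by apply/funext => p; rewrite mxE.
  case: unliftP => [k _|_]; last exact: measurable_fst.
  exact: measurableT_comp (measurable_coord k) measurable_snd.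
have fbox a b : f @^-1` (box a b) = `[hd a, hd b]%classic `*` box (tl a) (tl b).
  apply/seteqP; split => [[s v] H|[s v] [/= H1 H2]].
    split; first by have := H ord0; rewrite /= !mxE unlift_none in_itv.
    by move=> k; have := H (lift ord0 k); rewrite !mxE liftK.
  move=> j; rewrite !mxE; case: unliftP => [k ->|->]; last by move: H1;
    rewrite in_itv.
  by have := H2 k; rewrite !mxE.
exists (distribution (uniform_prob ab \x P)%E (mfun_Sub (mem_set mf))).
have E a b : distribution (uniform_prob ab \x P)%E (mfun_Sub (mem_set mf)) (box a b) =
   (uniform_prob ab `[hd a, hd b]%classic * P (box (tl a) (tl b)))%E.
  rewrite /distribution /pushforward /= fbox product_measure1E//.
  exact: measurable_box.
split.
  apply: etrans (E _ _) _;
    rewrite /hd !mxE /uniform_prob integral_uniform_pdf1// mul1e -[RHS]P1;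
    congr (P (box _ _)).
    by apply/rowP => i; rewrite !mxE.
  by apply/rowP => i; rewrite !mxE.
move=> a b le_ab.
apply: (@le_trans _ _ (uniform_prob ab `[hd a, hd b]%classic * P (box (tl a) (tl b)))%E).
  by rewrite -E.
apply: le_trans (lee_pmul _ _ (uniform_prob_itv_le _ (le_ab ord0)) (Pbox _ _ _)) _ => //.
  by move=> i; rewrite !mxE.
rewrite -EFinM lee_fin /volume big_ord_recl exprS invfM.
rewrite (_ : c 0 ord0 + r - _ = r + r); last by lra.
rewrite mulrACA le_eqVlt; apply/orP; left; apply/eqP; congr (_ * _ * _).
by apply: eq_bigr => i _; rewrite !mxE.
Qed.

(** A null set has countable box covers of arbitrarily small total volume, and the bound on boxes
    passes to it by subadditivity. *)
Lemma box_bounded_dominated m (P : probability (borelRV R m) R) (C : R) :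
  0 <= C -> (forall a b : 'rV[R]_m, (forall i, a 0 i <= b 0 i) ->
    (P (box a b) <= (C * volume a b)%:E)%E) ->
  P `<< @lebesgueRV R m.
Proof.
move=> C0 Pbox N N0 A mA AN; have := N0 A mA AN => LA.
apply/eqP; rewrite eq_le measure_ge0 andbT.
apply/lee_addgt0Pr => e e0; rewrite add0e.
have : (@lebesgueRV R m A < (e / (C + 1))%:E)%E.
  by rewrite LA lte_fin divr_gt0// ltr_wpDl.
move=> /ereal_inf_lt[_ [a [b [ab Acov ->]]] lt].
have mbox k : measurable (box (a k) (b k) : set (borelRV R m)) by exact: measurable_box.
apply: le_trans (@measure_sigma_subadditive _ _ _ P A _ mbox mA Acov) _.
apply: le_trans (lee_nneseries (v := fun k => (C%:E * (volume (a k) (b k))%:E)%E) _ _) _ => //.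
  by move=> k _; rewrite -EFinM; exact: Pbox.
rewrite nneseriesZl; last by move=> k _; rewrite lee_fin volume_ge0.
apply: le_trans (lee_wpmul2l _ (ltW lt)) _; first by rewrite lee_fin.
rewrite -EFinM lee_fin mulrCA ler_piMr ?(ltW e0)// ler_pdivrMr ?ltr_wpDl//.
by rewrite mul1r lerDl.
Qed.

End BorelRV.

(** * Integrals of concave combinations *)

Section IntegralConcavity.
Context d (T : measurableType d) (R : realType).
Variable mu : {measure set T -> \bar R}.
Implicit Types (D : set T) (f g : T -> R).
Local Open Scope ereal_scope.

(** Positive and negative parts are restricted separately, so that f may be non-integrable. *)
Lemma integral_negligible_restrict D D' f : measurable D -> measurable D' ->
  D `<=` D' -> mu (~` D) = 0 -> measurable_fun D' f ->
  \int[mu]_(x in D') (f x)%:E = \int[mu]_(x in D) (f x)%:E.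
Proof.
move=> mD mD' DD' D0 mf;
  have mF : measurable_fun D' (EFin \o f) by exact/measurable_EFinP.
have DE : D = D' `\` ~` D by rewrite setDE setCK setIC; apply/esym/setIidl.
have mC : measurable (~` D) by exact: measurableC.
rewrite integralE [RHS]integralE; congr (_ - _).
  rewrite [in RHS]DE; apply: ge0_negligible_integral => //.
  exact: measurable_funepos.
rewrite [in RHS]DE; apply: ge0_negligible_integral => //.
exact: measurable_funeneg.
Qed.

Lemma le_integral_measurable D f g : measurable D ->
  measurable_fun D f -> measurable_fun D g ->
  (forall x, D x -> (f x <= g x)%R) ->
  \int[mu]_(x in D) (f x)%:E <= \int[mu]_(x in D) (g x)%:E.
Proof.
move=> mD mf mg fg.
have mF : measurable_fun D (EFin \o f) by exact/measurable_EFinP.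
have mG : measurable_fun D (EFin \o g) by exact/measurable_EFinP.
rewrite integralE [leRHS]integralE leeB//; apply: ge0_le_integral => //.
- exact: measurable_funepos.
- exact: measurable_funepos.
- by move=> x Dx; rewrite !funeposE; apply: le_max2; rewrite ?lee_fin ?fg.
- exact: measurable_funeneg.
- exact: measurable_funeneg.
- by move=> x Dx; rewrite !funenegE; apply: le_max2; rewrite ?leeN2 ?lee_fin ?fg.
Qed.

(** The integrals may be infinite, so they cannot be combined linearly. The pointwise inequality is
    rewritten between nonnegative functions by moving each negative part to the other side; their
    integrals add up, and infinite values are treated by cases. *)
Lemma integral_concave D f0 f1 g (t : R) : measurable D ->
  measurable_fun D f0 -> measurable_fun D f1 -> measurable_fun D g ->
  (0 <= t <= 1)%R ->
  (forall x, D x -> ((1 - t) * f0 x + t * f1 x <= g x)%R) ->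
  (1 - t)%:E * \int[mu]_(x in D) (f0 x)%:E + t%:E * \int[mu]_(x in D) (f1 x)%:E
    <= \int[mu]_(x in D) (g x)%:E.
Proof.
move=> mD m0 m1 mg /andP[t0 t1] H.
(* The end values of t are treated apart: for 0 < t < 1 an infinite integral stays infinite after
   multiplication by t or 1 - t. *)
have [tE|tn0] := eqVneq t 0%R.
  rewrite tE subr0 mul1e mul0e adde0; apply: le_integral_measurable => // x Dx.
  by have := H x Dx; rewrite tE; lra.
have [tE|tn1] := eqVneq t 1%R.
  rewrite tE subrr mul1e mul0e add0e; apply: le_integral_measurable => // x Dx.
  by have := H x Dx; rewrite tE; lra.
have {}t0 : (0 < t)%R by rewrite lt_neqAle eq_sym tn0.
have {}t1 : (0 < 1 - t)%R by rewrite subr_gt0 lt_neqAle tn1.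
have mP f : measurable_fun D f -> measurable_fun D (EFin \o f)^\+.
  by move=> mf; apply: measurable_funepos; exact/measurable_EFinP.
have mN f : measurable_fun D f -> measurable_fun D (EFin \o f)^\-.
  by move=> mf; apply: measurable_funeneg; exact/measurable_EFinP.
pose P f := \int[mu]_(x in D) (EFin \o f)^\+ x.
pose N f := \int[mu]_(x in D) (EFin \o f)^\- x.
have P0 f : 0 <= P f by apply: integral_ge0.
have N0 f : 0 <= N f by apply: integral_ge0.
have comb a b h : measurable_fun D a -> measurable_fun D b -> measurable_fun D h ->
    (forall x, 0 <= a x) -> (forall x, 0 <= b x) -> (forall x, 0 <= h x) ->
    \int[mu]_(x in D) (h x + ((1 - t)%:E * a x + t%:E * b x)) =
    \int[mu]_(x in D) h x + ((1 - t)%:E * \int[mu]_(x in D) a x + t%:E * \int[mu]_(x in D) b x)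
    /\ measurable_fun D (fun x => h x + ((1 - t)%:E * a x + t%:E * b x)).
  move=> ma mb mh a0 b0 h0.
  have ma' : measurable_fun D (fun x => (1 - t)%:E * a x) by exact: measurable_funeM.
  have mb' : measurable_fun D (fun x => t%:E * b x) by exact: measurable_funeM.
  have ta x : 0 <= (1 - t)%:E * a x by rewrite mule_ge0// lee_fin ltW.
  have tb x : 0 <= t%:E * b x by rewrite mule_ge0// lee_fin ltW.
  have mab := emeasurable_funD ma' mb'.
  split; last exact: emeasurable_funD.
  rewrite ge0_integralD//; last by move=> x _; rewrite adde_ge0.
  by rewrite ge0_integralD// !ge0_integralZl_EFin// ltW.
have [E1 M1] := comb _ _ _ (mN _ m0) (mN _ m1) (mP _ mg)
  (funeneg_ge0 _) (funeneg_ge0 _) (funepos_ge0 _).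
have [E2 M2] := comb _ _ _ (mP _ m0) (mP _ m1) (mN _ mg)
  (funepos_ge0 _) (funepos_ge0 _) (funeneg_ge0 _).
have key : N g + ((1 - t)%:E * P f0 + t%:E * P f1) <=
    P g + ((1 - t)%:E * N f0 + t%:E * N f1).
  rewrite -E1 -E2; apply: ge0_le_integral => //.
    by move=> x _; rewrite !adde_ge0// mule_ge0// lee_fin ltW.
  move=> x Dx;
    rewrite !funeposE !funenegE /= -?EFinN -!EFin_max -!EFinM -!EFinD lee_fin.
  have := H x Dx; have mx (r : R) : Num.max r 0%R = (r + Num.max (- r) 0)%R.
    by have [r0|r0] := leP r 0%R; have [r1|r1] := leP (- r)%R 0%R; lra.
  rewrite (mx (f0 x)) (mx (f1 x)) (mx (g x)); lra.
(* If N f0 and N f1 are finite this makes N g finite, so that it can be subtracted in [key];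
   otherwise the left-hand side of the goal is -oo. *)
have key2 : N g <= (1 - t)%:E * N f0 + t%:E * N f1.
  have [E3 M3] := comb _ _ _ (mN _ m0) (mN _ m1) (@measurable_cst _ _ _ _ D 0)
    (funeneg_ge0 _) (funeneg_ge0 _) (fun=> lexx _).
  rewrite integral0 add0e in E3; rewrite -E3; apply: ge0_le_integral => //.
    exact: mN.
  move=> x Dx; rewrite !funenegE /= add0e -?EFinN -!EFin_max -!EFinM -!EFinD lee_fin.
  have A0 : (- f0 x <= Num.max (- f0 x) 0 /\ 0 <= Num.max (- f0 x) 0)%R by rewrite !le_max !lexx orbT.
  have A1 : (- f1 x <= Num.max (- f1 x) 0 /\ 0 <= Num.max (- f1 x) 0)%R by rewrite !le_max !lexx orbT.
  move: A0 A1;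
    move: (Num.max (- f0 x) 0)%R (Num.max (- f1 x) 0)%R => a b [a1 a2] [b1 b2].
  rewrite ge_max; apply/andP; split; last by rewrite addr_ge0// mulr_ge0// ltW.
  have := H x Dx.
  have : ((1 - t) * - f0 x <= (1 - t) * a)%R by rewrite ler_wpM2l// ltW.
  have : (t * - f1 x <= t * b)%R by rewrite ler_wpM2l// ltW.
  lra.
rewrite integralE [X in _ + t%:E * X]integralE [leRHS]integralE.
rewrite -!/(P _) -!/(N _).
have [N0y|N0f] := eqVneq (N f0) +oo.
  by rewrite N0y addeNy gt0_muleNy ?lte_fin// leNye.
have [N1y|N1f] := eqVneq (N f1) +oo.
  by rewrite N1y addeNy gt0_muleNy ?lte_fin// addeNy leNye.
have fin f : N f != +oo -> N f \is a fin_num.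
  by move=> ?; rewrite ge0_fin_numE// ltey.
move: (fin _ N0f) (fin _ N1f) key key2 (N0 g) (P0 f0) (P0 f1) (P0 g).
case: (N f0) => // n0 _; case: (N f1) => // n1 _.
have cE (a b : R) : (1 - t)%:E * a%:E + t%:E * b%:E = ((1 - t) * a + t * b)%:E by [].
rewrite cE; case: (N g) => [ng|_|_ _]; last 2 first.
- by rewrite leye_eq.
- by rewrite leeNy_eq.
case: (P g) => [pg|_ _ _ _ _ _|_ _ _ _ _]; last 2 first.
- by rewrite leey.
- by rewrite leeNy_eq.
case: (P f0) => [p0|k|_ _ _]; last 2 first.
- move: k; case: (P f1) => [p1|k|_ _ _ _]; last by rewrite leeNy_eq.
    by rewrite gt0_muley ?lte_fin.
  by move: k; rewrite !gt0_muley ?lte_fin.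
- by rewrite leeNy_eq.
case: (P f1) => [p1|k|_ _ _ _]; last 2 first.
- by move: k; rewrite gt0_muley ?lte_fin.
- by rewrite leeNy_eq.
rewrite -!EFinB !cE -!EFinD !lee_fin; lra.
Qed.

End IntegralConcavity.

(** * The profit functional *)

Section ProfitConcavity.
Context {R : realType} {m n : nat}.
Variables (X : set 'rV[R]_m) (Q : set (yzT R n)).
Variables (G : xyzT R m n -> R) (dG : xyzT R m n -> xyzT R m n).
Variable profit : xyzT R m n -> R.
Hypotheses (oX : open X) (bX : bounded_set X).
Hypothesis C1 : C1_closure (X `*` Q) G dG.
Hypothesis G1 : hypG1 X (closure Q) G dG.
Hypothesis G2 : hypG2 X (closure Q) G dG.
Hypothesis G3 : hypG3 X (closure Q) G dG.
Hypothesis cprofit : {within closure (X `*` Q), continuous profit}.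

Implicit Types (x : 'rV[R]_m) (q r : yzT R n) (u : 'rV[R]_m -> R^o).

Local Notation Gconvex := (G_convex_on X Q G).
Local Notation supp := (supports X Q G).

Definition smooth_points u : set 'rV[R]_m := X `&` [set x | differentiable u x].

Definition profit_at u x : R :=
  profit (x, ybarG G dG (closure Q) x (u x) (gradient u x)).

Lemma near_profit x q e : X x -> closure Q q -> 0 < e ->
  exists2 d : R, 0 < d & forall x' q', X x' -> closure Q q' ->
    `|x' - x| < d -> `|q' - q| < d -> `|profit (x, q) - profit (x', q')| < e.
Proof.
move=> Xx Qq e0; have /subspace_continuousP/(_ (x, q)) := cprofit.
rewrite closure_setX => /(_ (conj (subset_closure Xx) Qq)).
move=> /cvgrPdist_lt /(_ e e0) [[V1 V2] /= [/near_distP[d1 d10 H1] /near_distP[d2 d20 H2]] sV].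
exists (Num.min d1 d2); first by rewrite lt_min d10.
move=> x' q' Xx' Qq'; rewrite !lt_min => /andP[x1 _] /andP[_ q2].
exact: (sV (x', q') (conj (H1 _ x1) (H2 _ q2)) (conj (subset_closure Xx') Qq')).
Qed.

(** The support at a smooth point is unique, so by [supports_near] the supports at nearby smooth
    points, which are the values of ybarG, are close to it. *)
Lemma profit_at_near u x0 e : Gconvex u -> smooth_points u x0 -> 0 < e ->
  exists2 d : R, 0 < d & forall x, smooth_points u x -> `|x - x0| < d ->
    `|profit_at u x0 - profit_at u x| < e.
Proof.
move=> cu [Xx0 du0] e0; have s0 := ybarG_support oX C1 G1 cu Xx0 du0.
have [Q0 _ _] := s0; have [d1 d10 H1] := near_profit Xx0 Q0 e0.
have uniq q : supp u x0 q -> q = ybarG G dG (closure Q) x0 (u x0) (gradient u x0).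
  by move=> sq; exact: (differentiable_support_unique oX C1 G1 Xx0 du0 sq s0).
have /near_distP[d2 d20 H2] := supports_near oX C1 G1 G2 G3 cu Xx0 s0 uniq d10.
exists (Num.min d1 d2); first by rewrite lt_min d10.
move=> x [Xx dux]; rewrite lt_min => /andP[x1 x2].
have sx := ybarG_support oX C1 G1 cu Xx dux.
by apply: H1 => //; [by have [] := sx|exact: H2 sx].
Qed.

Lemma profit_at_continuous u : Gconvex u ->
  {within smooth_points u, continuous (profit_at u)}.
Proof.
move=> cu; apply/subspace_continuousP => x0 Dx0; apply/cvgrPdist_lt => e e0.
have [d d0 Hd] := profit_at_near cu Dx0 e0.
by apply/(@near_distP R 'rV[R]_m x0); exists d => // x xd Dx; exact: Hd.
Qed.

Definition kink_index := ('I_m * (rat * rat) * (nat * rat))%type.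

(** The empty set stands for the pairs with a >= b, so that the whole countable type can serve as
    index set. *)
Definition kink_set u (p : kink_index) : set (borelRV R m) :=
  if p.1.2.1 < p.1.2.2 then kinks X u p.1.1 p.1.2.1 p.1.2.2 p.2.1 p.2.2
  else set0.

Lemma smooth_pointsE u : Gconvex u ->
  smooth_points u = X `\` \bigcup_p kink_set u p.
Proof.
move=> cu; apply/seteqP; split => [x [Xx dux]|x [Xx nk]].
  split => // -[[[i [a b]] [k c]] _]; rewrite /kink_set/=; case: ifP => // ab kx.
  have [_] := not_differentiable_kinks oX C1 G1 G2 G3 cu Xx.
  by apply => //; exists i, a, b, k, c.
split => //; apply: contrapT => nd; apply: nk.
have [H _] := not_differentiable_kinks oX C1 G1 G2 G3 cu Xx.
have [i [a [b [k [c [ab kx]]]]]] := H nd.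
by exists (i, (a, b), (k, c)) => //; rewrite /kink_set /= ab.
Qed.

Lemma closed_kink_set u p : Gconvex u -> closed (kink_set u p : set 'rV[R]_m).
Proof.
by move=> cu; rewrite /kink_set; case: ifP => _;
  [exact: (closed_kinks oX cu)|exact: closed0].
Qed.

Lemma lebesgueRV_kink_set u p : Gconvex u -> lebesgueRV (kink_set u p) = 0%E.
Proof.
move=> cu; apply: (lebesgueRV_graph (i := p.1.1)).
  apply: bounded_closed_compact; last exact: closed_kink_set.
  have [M [Mr HM]] := bX; exists M; split=> // N MN x kx; apply: HM MN _ _.
  move: kx; by rewrite /kink_set; case: ifP => // _; exact: kinks_sub.
rewrite /kink_set; case: ifP => // ab x y; exact: kinks_graph.
Qed.

Lemma measurable_smooth_points u : Gconvex u ->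
  measurable (smooth_points u : set (borelRV R m)).
Proof.
move=> cu; rewrite smooth_pointsE//; apply: measurableD.
  exact: open_measurableRV.
apply: measurable_bigcup_countType => p; apply: closed_measurableRV.
exact: closed_kink_set.
Qed.

Lemma measurable_profit_at u : Gconvex u ->
  measurable_fun (smooth_points u : set (borelRV R m)) (profit_at u).
Proof.
move=> cu; apply: within_continuous_measurable.
  exact: measurable_smooth_points.
exact: profit_at_continuous.
Qed.

Lemma smooth_points_conull (mu : probability (borelRV R m) R) u :
  mu X = 1%E -> mu `<< @lebesgueRV R m -> Gconvex u ->
  mu (~` smooth_points u) = 0%E.
Proof.
move=> muX dom cu;
  have mX : measurable (X : set (borelRV R m)) by exact: open_measurableRV.
have mK p : measurable (kink_set u p).
  by apply: closed_measurableRV; exact: closed_kink_set.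
have nX : mu (~` X) = 0%E.
  have -> : mu (~` X) = (1 - mu X)%E by exact: probability_setC.
  by rewrite muX subee.
rewrite smooth_pointsE// setDE setCI setCK; apply: null_set_setU => //.
- exact: measurableC.
- exact: measurable_bigcup_countType.
apply: measure_bigcup_countType0 => // p.
apply: (dom (kink_set u p)) => // A mA AK; apply/eqP.
by rewrite eq_le lebesgueRV_ge0 andbT -(lebesgueRV_kink_set p cu) le_lebesgueRV.
Qed.

Lemma profit_functionalE mu u :
  profit_functional X (closure Q) G dG profit mu u =
  (\int[mu]_(x in (smooth_points u : set (borelRV R m))) (profit_at u x)%:E)%E.
Proof. by []. Qed.

Lemma profit_functional_concave (mu : probability (borelRV R m) R) u0 u1 t :
  (forall x, X x -> forall q0 q1 (q : R -> yzT R n),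
     G_segment G dG (closure Q) x q0 q1 q ->
     @concave_function R R^o `[0, 1] (fun t => profit (x, q t))) ->
  mu X = 1%E -> mu `<< @lebesgueRV R m -> Gconvex u0 -> Gconvex u1 ->
  0 <= t <= 1 ->
  ((1 - t)%:E * profit_functional X (closure Q) G dG profit mu u0 +
   t%:E * profit_functional X (closure Q) G dG profit mu u1 <=
   profit_functional X (closure Q) G dG profit mu ((1 - t) *: u0 + t *: u1)%R)%E.
Proof.
move=> conc muX dom c0 c1 t01; set ut := (_ *: _ + _ *: _)%R.
have ct : Gconvex ut by exact: (G_convex_on_conv oX G1 G2 G3).
(* The three integrals are restricted to the common smooth points, whose complement is null; there
   the integrands are compared pointwise. *)
pose D : set (borelRV R m) := smooth_points u0 `&` smooth_points u1 `&` smooth_points ut.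
have mD : measurable D.
  by apply: measurableI; [apply: measurableI|]; exact: measurable_smooth_points.
have D0 : mu (~` D) = 0%E.
  have cn u (cu : Gconvex u) := smooth_points_conull muX dom cu.
  have mC u : Gconvex u -> measurable (~` smooth_points u : set (borelRV R m)).
    by move=> cu; apply: measurableC; exact: measurable_smooth_points.
  rewrite /D (setCI (_ `&` _) (smooth_points ut)).
  rewrite (setCI (smooth_points u0) (smooth_points u1)).
  apply: null_set_setU; [by apply: measurableU; exact: mC|exact: mC| |exact: cn].
  by apply: null_set_setU; [exact: mC|exact: mC|exact: cn|exact: cn].
have red u : Gconvex u -> D `<=` smooth_points u ->
    profit_functional X (closure Q) G dG profit mu u =
    (\int[mu]_(x in D) (profit_at u x)%:E)%E.
  move=> cu Du; rewrite profit_functionalE;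
    apply: integral_negligible_restrict => //.
    exact: measurable_smooth_points.
  exact: measurable_profit_at.
rewrite !red//; [|by move=> x []|by move=> x [[]]|by move=> x [[]]].
have mf u : Gconvex u -> D `<=` smooth_points u -> measurable_fun D (profit_at u).
  move=> cu Du; apply: measurable_funS (measurable_profit_at cu) => //.
  exact: measurable_smooth_points.
apply: integral_concave => //;
  [by apply: mf => // x [[]]|by apply: mf => // x [[]]|by apply: mf => // x []|].
move=> x [[[Xx d0] [_ d1]] [_ dt]].
have s0 := ybarG_support oX C1 G1 c0 Xx d0.
have s1 := ybarG_support oX C1 G1 c1 Xx d1.
have st := ybarG_support oX C1 G1 ct Xx dt.
have [Q0 _ _] := s0; have [Q1 _ _] := s1.
have [q Sq _] := G_segment_exists G1 G2 Xx Q0 Q1.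
have [q0E q1E] := G_segment_ends G1 Xx Sq.
have := concave_function01 (conc x Xx _ _ q Sq) t01.
rewrite q0E q1E /profit_at => H; apply: le_trans H _.
(* The point q t supports [ut] at x, so it is the value of ybarG there. *)
rewrite (differentiable_support_unique oX C1 G1 Xx dt st (supports_conv G1 G3 Xx Sq s0 s1 t01)).
exact: lexx.
Qed.

Lemma G_differentiable x q : X x -> closure Q q ->
  differentiable (fun x => G (x, q) : R^o) x.
Proof.
move=> Xx Qq; apply: (differentiable_near_le (df := dotrV (dG (x, q)).1)).
  exact: dotrV_continuous.
move=> e e0; have [d d0 Hd] := G_strict_diff oX C1 Xx Qq e0.
exists d => // y yd; have := Hd x y q Qq.
by rewrite !subrr !normr0 => /(_ d0 d0 yd).
Qed.

Lemma segment_concave_of_functional x0 q0 q1 (q : R -> yzT R n) t :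
  (forall mu : probability (borelRV R m) R, mu X = 1%E -> mu `<< @lebesgueRV R m ->
   forall u0 u1, Gconvex u0 -> Gconvex u1 -> forall t : R, 0 <= t <= 1 ->
   ((1 - t)%:E * profit_functional X (closure Q) G dG profit mu u0 +
   t%:E * profit_functional X (closure Q) G dG profit mu u1 <=
   profit_functional X (closure Q) G dG profit mu ((1 - t) *: u0 + t *: u1)%R)%E) ->
  X x0 -> G_segment G dG (closure Q) x0 q0 q1 q -> 0 <= t <= 1 ->
  (1 - t) * profit (x0, q0) + t * profit (x0, q1) <= profit (x0, q t).
Proof.
move=> conc Xx0 Sq t01; rewrite leNgt; apply/negP => gap.
have [Q0 Q1 _] := Sq.
pose u0 x : R^o := G (x, q0); pose u1 x : R^o := G (x, q1).
pose ut := (1 - t) *: u0 + t *: u1.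
have c0 : Gconvex u0 by exact: (G_convex_on_G oX C1).
have c1 : Gconvex u1 by exact: (G_convex_on_G oX C1).
have ct : Gconvex ut by exact: (G_convex_on_conv oX G1 G2 G3).
have s0 := G_supports X G x0 Q0; have s1 := G_supports X G x0 Q1.
have st := supports_conv G1 G3 Xx0 Sq s0 s1 t01.
have D0 : smooth_points u0 = X.
  by apply/seteqP; split => [x []|x Xx] //; split => //; exact: G_differentiable.
have D1 : smooth_points u1 = X.
  by apply/seteqP; split => [x []|x Xx] //; split => //; exact: G_differentiable.
(* The point q t is known to support [ut] at x0 alone; differentiability on all of X gives the
   continuity of the integrand around x0. *)
have Dt : smooth_points ut = X.
  apply/seteqP; split => [x [Xx _]|x Xx]; first exact: Xx.
  split; first exact: Xx.
  have d0 : differentiable u0 x by exact: G_differentiable.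
  have d1 : differentiable u1 x by exact: G_differentiable.
  exact: (differentiableD (differentiableZ (1 - t) d0) (differentiableZ t d1)).
have at0 u r : smooth_points u = X -> Gconvex u -> supp u x0 r ->
    profit_at u x0 = profit (x0, r).
  move=> Du cu sr; rewrite /profit_at;
    have [_ du] : smooth_points u x0 by rewrite Du.
  have sy := ybarG_support oX C1 G1 cu Xx0 du.
  by rewrite (differentiable_support_unique oX C1 G1 Xx0 du sy sr).
(* Each of the three integrals is within e of the value at x0, so concavity would bound the gap by 2
   e, while it equals 4 e. *)
set gp := (1 - t) * _ + _ in gap; pose e := (gp - profit (x0, q t)) / 4.
have e0 : 0 < e by rewrite divr_gt0// subr_gt0.
have near0 u r : smooth_points u = X -> Gconvex u -> supp u x0 r ->
   exists2 d : R, 0 < d & forall x, X x -> `|x - x0| < d ->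
    `|profit (x0, r) - profit_at u x| < e.
  move=> Du cu sr; have [|d d0 Hd] := @profit_at_near u x0 e cu _ e0;
    first by rewrite Du.
  by exists d => // x Xx; rewrite -(at0 u)//; apply: Hd; rewrite Du.
have [d0 d00 H0] := near0 _ _ D0 c0 s0.
have [d1 d10 H1] := near0 _ _ D1 c1 s1.
have [d2 d20 H2] := near0 _ _ Dt ct st.
have /near_distP[d3 d30 H3] : \forall x' \near x0, X x' by exact: open_nbhs_nbhs.
pose rho := Num.min (Num.min d0 d1) (Num.min d2 d3).
have rho0 : 0 < rho by rewrite !lt_min d00 d10 d20.
(* Half of rho, so that the closed cube lies in the open ball of radius rho. *)
pose r := rho / 2; have r0 : 0 < r by rewrite divr_gt0.
have [P [P1 Pbox]] := uniform_box_exists r0 x0.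
set B := box _ _ in P1.
have Brho x : B x -> `|x - x0| < rho.
  move=> Bx; apply/rV_norm_lt => // i; have := Bx i; rewrite !mxE ltr_norml /r.
  by move: rho0; set w := rho; lra.
have BX : B `<=` X.
  by move=> x /Brho; rewrite !lt_min => /andP[_ /andP[_ /H3]].
have mB : measurable (B : set (borelRV R m)) by exact: measurable_box.
have mX : measurable (X : set (borelRV R m)) by exact: open_measurableRV.
have PX : P X = 1%E.
  by apply/eqP; rewrite eq_le probability_le1//= -P1 le_measure// inE.
have dom : P `<< @lebesgueRV R m.
  apply: (box_bounded_dominated (C := (r + r) ^- m)) => [|a b ab].
    by rewrite invr_ge0 exprn_ge0// addr_ge0// ltW.
  by rewrite mulrC; exact: Pbox.
have PB : P (~` B) = 0%E.
  have -> : P (~` B) = (1 - P B)%E by exact: probability_setC.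
  by rewrite [P B]P1 subee.
have red u : smooth_points u = X -> Gconvex u ->
    profit_functional X (closure Q) G dG profit P u =
    (\int[P]_(x in (B : set (borelRV R m))) (profit_at u x)%:E)%E /\
    measurable_fun (B : set (borelRV R m)) (profit_at u).
  move=> Du cu; have := measurable_profit_at cu; rewrite Du => mf; split.
    by rewrite profit_functionalE Du; exact: integral_negligible_restrict.
  exact: measurable_funS mf.
have cstB c : (\int[P]_(x in (B : set (borelRV R m))) (cst c x)%:E)%E = c%:E.
  have cP : (c%:E * P B = c%:E)%E by rewrite P1 mule1.
  exact: etrans (integral_cst P mB c%:E) cP.
have lo u c : smooth_points u = X -> Gconvex u -> (forall x, B x -> c <= profit_at u x) ->
    (c%:E <= profit_functional X (closure Q) G dG profit P u)%E.
  move=> Du cu H; have [-> mf] := red u Du cu.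
  by rewrite -(cstB c); apply: le_integral_measurable.
have hi u c : smooth_points u = X -> Gconvex u -> (forall x, B x -> profit_at u x <= c) ->
    (profit_functional X (closure Q) G dG profit P u <= c%:E)%E.
  move=> Du cu H; have [-> mf] := red u Du cu.
  by rewrite -(cstB c); apply: le_integral_measurable.
have L0 : ((profit (x0, q0) - e)%:E <= profit_functional X (closure Q) G dG profit P u0)%E.
  apply: lo => // x Bx; have := Brho x Bx; rewrite !lt_min => /andP[/andP[xd _] _].
  by have := H0 x (BX _ Bx) xd; rewrite ltr_norml; lra.
have L1 : ((profit (x0, q1) - e)%:E <= profit_functional X (closure Q) G dG profit P u1)%E.
  apply: lo => // x Bx; have := Brho x Bx; rewrite !lt_min => /andP[/andP[_ xd] _].
  by have := H1 x (BX _ Bx) xd; rewrite ltr_norml; lra.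
have Lt : (profit_functional X (closure Q) G dG profit P ut <= (profit (x0, q t) + e)%:E)%E.
  apply: hi => // x Bx; have := Brho x Bx; rewrite !lt_min => /andP[_ /andP[xd _]].
  by have := H2 x (BX _ Bx) xd; rewrite ltr_norml; lra.
have Hc := conc P PX dom u0 u1 c0 c1 t t01.
have gapE : gp - profit (x0, q t) = e * 4 by rewrite /e divfK.
move: Hc L0 L1 Lt; rewrite -/ut.
move: (profit_functional _ _ _ _ _ _ u0) (profit_functional _ _ _ _ _ _ u1)
  (profit_functional _ _ _ _ _ _ ut) => A0 A1 At Hc L0 L1 Lt.
move: t01 => /andP[t0 t1].
have L01 : ((1 - t)%:E * (profit (x0, q0) - e)%:E + t%:E * (profit (x0, q1) - e)%:E <=
    (1 - t)%:E * A0 + t%:E * A1)%E.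
  by apply: leeD; apply: lee_wpmul2l => //; rewrite lee_fin// subr_ge0.
have := le_trans L01 (le_trans Hc Lt); rewrite -!EFinM -EFinD lee_fin.
by move: gapE e0; rewrite /gp; lra.
Qed.

End ProfitConcavity.

(** * The equivalence *)

Lemma G_convexE (R : realType) (m n : nat) (X : set 'rV[R]_m) (Y : set 'rV[R]_n)
    (Z : set R) (G : xyzT R m n -> R) :
  G_convex X Y Z G = G_convex_on X (Y `*` Z) G.
Proof.
apply/seteqP; split=> u [cu H]; split=> // x Xx.
  by have [y [z [Yy Zz E le]]] := H x Xx; exists (y, z); split;
    rewrite ?closure_setX.
by have [[y z] [+ E le]] := H x Xx; rewrite closure_setX => -[]; exists y, z.
Qed.

Unset Implicit Arguments.

Theorem theorem4p2 (R : realType) (m n : nat) (n_gt0 : (0 < n)%N)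
    (le_nm : (n <= m)%N) (X : set 'rV[R]_m) (Y : set 'rV[R]_n)
    (zlo : R) (zhi : \bar R)
    (G : 'rV[R]_m * ('rV[R]_n * R) -> R)
    (dG : 'rV[R]_m * ('rV[R]_n * R) -> 'rV[R]_m * ('rV[R]_n * R))
    (profit : 'rV[R]_m * ('rV[R]_n * R) -> R) (q_null : 'rV[R]_n * R)
    (hG0 : hypG0 X Y zlo zhi G dG)
    (hG1 : hypG1 X (closure (Y `*` Zset zlo zhi)) G dG)
    (hG2 : hypG2 X (closure (Y `*` Zset zlo zhi)) G dG)
    (hG3 : hypG3 X (closure (Y `*` Zset zlo zhi)) G dG)
    (hG4 : hypG4 X Y (Zset zlo zhi) dG)
    (hG5 : hypG5 X Y zlo zhi G profit q_null) :
  (forall x, X x -> forall q0 q1 q,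
     G_segment G dG (closure (Y `*` Zset zlo zhi)) x q0 q1 q ->
     @concave_function R R^o `[0, 1] (fun t => profit (x, q t)))
  <->
  (forall mu : probability (borelRV R m) R,
     mu X = 1%E -> mu `<< @lebesgueRV R m ->
     concave_functional (G_convex X Y (Zset zlo zhi) G)
       (profit_functional X (closure (Y `*` Zset zlo zhi)) G dG profit mu)).
Proof.
have [[oX bX] _ _ C1] := hG0; have [cprofit _ _ _] := hG5.
rewrite G_convexE; split=> [conc mu muX dom|conc x Xx q0 q1 q Sq].
  split.
    move=> u0 u1 t; rewrite !inE => c0 c1.
    have t01 : 0 <= t%:num <= 1 by rewrite ge0 le1.
    by have := G_convex_on_conv oX hG1 hG2 hG3 c1 c0 t01; rewrite addrC.
  move=> u0 u1 c0 c1 t t01.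
  exact: (profit_functional_concave oX bX C1 hG1 hG2 hG3 cprofit).
move=> t a b; rewrite !inE/= => a01 b01.
have t01 : 0 <= t%:num <= 1 by rewrite ge0 le1.
have [_ _ Hq] := Sq; rewrite !in_itv/= in a01 b01.
have [Qa Ea] := Hq a a01; have [Qb Eb] := Hq b b01.
(* An arc of a G-segment, affinely reparametrised, is again a G-segment, which reduces concavity on
   [0, 1] to the inequality between end points. It runs from q b to q a because [conv t a b] puts
   the weight t on a. *)
have Sab : G_segment G dG (closure (Y `*` Zset zlo zhi)) x (q b) (q a)
    (fun s => q ((1 - s) * b + s * a)).
  split => // s s01.
  have cs01 : 0 <= (1 - s) * b + s * a <= 1.
    by move: a01 b01 s01 => /andP[? ?] /andP[? ?] /andP[? ?]; apply/andP; split; nra.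
  have [Qs ->] := Hq _ cs01; split=> //; rewrite Ea Eb !scalerDr !scalerA addrACA.
  by rewrite -!scalerDl; congr (_ *: _ + _ *: _); ring.
have := @segment_concave_of_functional _ _ _ _ _ _ _ _ oX C1 hG1 hG2 hG3 cprofit
  x (q b) (q a) _ t%:num _ Xx Sab t01.
have -> : conv t a b = (1 - t%:num) * b + t%:num * a by exact: addrC.
move=> H; rewrite -[leRHS]opprK lerN2; apply: le_trans (H _).
  have -> : conv t (- profit (x, q a) : R^o) (- profit (x, q b)) =
    t%:num * - profit (x, q a) + (1 - t%:num) * - profit (x, q b) by [].
  by rewrite opprD !mulrN !opprK addrC.
move=> mu muX dom u0 u1 c0 c1 s s01; have [_ F] := conc mu muX dom.
exact: F.
Qed.
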